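(* For every $\varepsilon>0$ there is a constant $C_\varepsilon>0$ such that for all $m,n\in\mathbb{N}$ and all integers $k\ge5$ $$f_k(m,n)\le C_\varepsilon\,(kn)^{\varepsilon}\left(\frac{k^{4/3}n^2}{m}\right)^{\frac85\cdot 2^{k-5}}.$$
   Context: $\mathbb{N}$ denotes the positive integers. For $k,m,n\in\mathbb{N}$, $$f_k(m,n)=\left|\left\{(a_1,\ldots,a_k)\in\mathbb{N}^k:\ a_1\le\cdots\le a_k,\ \frac{m}{n}=\sum_{i=1}^k\frac1{a_i}\right\}\right|.$$ *)

(* Defs.v *)
From mathcomp Require Import all_boot all_order all_algebra.
From mathcomp Require Import finmap.
From mathcomp Require Import all_classical.

Set Implicit Arguments.
Unset Strict Implicit.
Unset Printing Implicit Defensive.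

Import Order.TTheory GRing.Theory Num.Theory.

Local Open Scope classical_set_scope.
Local Open Scope ring_scope.

(* The positive integers are rendered as the [i : nat] with [(0 < i)%N]. *)
Definition egyptian_tuples (k m n : nat) : set (k.-tuple nat) :=
  [set a | [/\ (forall i : 'I_k, (0 < tnth a i)%N),
               (forall i j : 'I_k, (i <= j)%N -> (tnth a i <= tnth a j)%N) &
               m%:R / n%:R = \sum_(i < k) (tnth a i)%:R^-1 :> rat]].
Arguments egyptian_tuples : clear implicits.

(* [fset_set A] has the elements of [A] when [A] is finite and is empty
   otherwise; only the first case occurs, by [finite_egyptian_tuples] below. *)
Definition egyptian_count (k m n : nat) : nat :=
  #|` fset_set (egyptian_tuples k m n)|.

Lemma egyptian_seq_bounded (k : nat) (q : rat) :
  exists N : nat, forall s : seq nat, size s = k -> sorted leq s ->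
    all (fun x => 0 < x)%N s -> q = \sum_(x <- s) x%:R^-1 ->
    all (fun x => x < N)%N s.
Proof.
elim: k q => [|k IH] q.
  by exists 0%N => s /size0nil ->.
have [h hP] := choice (fun a : nat => IH (q - a%:R^-1)).
pose B := (Num.bound (k.+1%:R / q)).+1.
exists (B + \sum_(i < B) h i)%N => -[//|a s] [sz] srt /= /andP[a0 s0].
rewrite big_cons => qE.
have aB : (a < B)%N.
  have q0 : 0 < q.
    rewrite qE ltr_pwDl ?invr_gt0 ?ltr0n//.
    by apply: sumr_ge0 => i _; rewrite invr_ge0.
  have qle : q <= k.+1%:R / a%:R.
    have -> : k.+1%:R / a%:R = a%:R^-1 + \sum_(x <- s) a%:R^-1 :> rat.
      rewrite big_const_seq count_predT sz iter_addr_0 -mulrS.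
      by rewrite -[RHS]mulr_natl.
    rewrite qE lerD2l big_seq [leRHS]big_seq; apply: ler_sum => x xs.
    have := order_path_min leq_trans srt => /allP/(_ _ xs) ax.
    by rewrite lef_pV2 ?posrE ?ltr0n ?ler_nat// (leq_trans a0).
  rewrite ltnS -(ler_nat rat).
  apply: (@le_trans _ _ (k.+1%:R / q)).
    by rewrite ler_pdivlMr// mulrC -ler_pdivlMr// ltr0n.
  apply/ltW; apply: archi_boundP; rewrite divr_ge0// ltW//.
have qs : q - a%:R^-1 = \sum_(x <- s) x%:R^-1 by rewrite qE addrAC subrr add0r.
have sh := hP a s sz (path_sorted srt) s0 qs.
apply/andP; split; first by rewrite (leq_trans aB)// leq_addr.
apply: sub_all sh => x xh; apply: (leq_trans xh).
by rewrite (bigD1 (Ordinal aB)) //= addnCA leq_addr.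
Qed.

Lemma finite_egyptian_tuples (k m n : nat) : finite_set (egyptian_tuples k m n).
Proof.
have [N NP] := egyptian_seq_bounded k (m%:R / n%:R).
apply: (@sub_finite_set _ _
  ((fun t : k.-tuple 'I_N => [tuple of map val t]) @` setT)); last first.
  exact/finite_image/finite_finset.
move=> a [a0 amono aE].
have aN : all (fun x => x < N)%N a.
  apply: NP; first by rewrite size_tuple.
  - apply/(sortedP 0%N) => i; rewrite size_tuple => ik.
    have := amono (Ordinal (ltnW ik)) (Ordinal ik) (leqnSn i).
    by rewrite !(tnth_nth 0%N).
  - by apply/all_tnthP => i; apply: a0.
  - by rewrite aE big_tuple.
have aNi (i : 'I_k) : (tnth a i < N)%N by apply: (allP aN); exact: mem_tnth.
exists [tuple Ordinal (aNi i) | i < k] => //.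
by apply: eq_from_tnth => i; rewrite tnth_map tnth_mktuple.
Qed.

(* Main.v *)
(** Peeling off the smallest denominator [a] turns [m / n] into [u / (n a)] with
    [u = m a - n]. With [X = n ^ 2 / m], a bound [f_k <= D X ^ E], [E > 1], gives
    [f_(k+1) <= D' X ^ (2 E)] with [D' / D] depending on [k] and [E] only, because
    [\sum_u u ^ (- E)] converges; for large [k] the loss [D' / D] is absorbed by the
    factor [k ^ (4 / 3 E)]. So everything rests on [f_5 <= C X ^ (8 / 5)], and in
    fact [f_5] is at most [X ^ (3 / 2)] up to divisor functions.

    For four denominators [a <= b <= c <= d] put [u = m a - n], [N = n a],
    [v = u b - N], [G = gcd (b, c)], [b = G x], [c = G y], [h = gcd (a, G)],
    [G = h g]. Up to a divisor-bounded number of choices a solution is determined by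
    [(a, h, g)], by [(x, y, h)], and by [v], so the sums over all solutions of
    [1 / (x y h)] and [1 / v] are negligible, and that of [1 / (g u)] is essentially
    [sigma = \sum_a 1 / (m a - n)]. Since [g ^ 2 u ^ 2 (x y h) v <= 18 N ^ 3], two
    applications of Cauchy-Schwarz bound [f_4 ^ 2] by [(n ^ 3 / m) sigma]. Summing
    over one more denominator, the sums [sigma] together contribute little, as
    [v = u b - n a] and [u = m a - n] imply that [u] divides [m v + n ^ 2]. *)

Require Import Defs.
From mathcomp Require Import all_boot all_order all_algebra.
From mathcomp Require Import finmap zify ring lra.
From mathcomp Require Import all_classical all_reals all_analysis.

Set Implicit Arguments.
Unset Strict Implicit.
Unset Printing Implicit Defensive.

Import Order.TTheory GRing.Theory Num.Theory.
Local Open Scope ring_scope.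

(** * Divisor functions and harmonic sums *)

Notation tau n := (size (divisors n)).

Lemma leq_expn2r j a b : (a <= b -> a ^ j <= b ^ j)%N.
Proof. by case: j => // j ab; rewrite leq_exp2r. Qed.

(** [(e + 1) ^ j] is at most the falling factorial [(e + j) ^_ j], which is [j!] times a binomial
    coefficient of [e + j], and that coefficient is at most [2 ^ (e + j)]. *)
Lemma succ_expn_le j e : (e.+1 ^ j <= j`! * 2 ^ j * 2 ^ e)%N.
Proof.
rewrite -mulnA -expnD.
apply: (@leq_trans ((e + j) ^_ j)%N).
  elim: j => [|j IH]; first by rewrite ffactn0.
  by rewrite expnS addnS ffactSS leq_mul// ltnS leq_addr.
rewrite -bin_ffact mulnC leq_mul2l; apply/orP; right.
have := expnDn 1 1 (e + j); rewrite addn1 addnC => ->.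
have h : (j < (j + e).+1)%N by rewrite ltnS leq_addr.
by rewrite (bigD1 (Ordinal h))//= !exp1n !muln1 leq_addr.
Qed.

(** A divisor [d] of [a b] is the product of [gcd (d, a)], which divides [a], and of
    [d / gcd (d, a)], which divides [b]. *)
Lemma divisors_mul_le a b : (0 < a)%N -> (0 < b)%N ->
  (tau (a * b) <= tau a * tau b)%N.
Proof.
move=> a0 b0.
rewrite -(size_allpairs muln).
apply: uniq_leq_size; first exact: divisors_uniq.
move=> d; rewrite -dvdn_divisors ?muln_gt0 ?a0// => dab.
have -> : d = (gcdn d a * (d %/ gcdn d a))%N by rewrite mulnC divnK// dvdn_gcdl.
apply: allpairs_f; rewrite -dvdn_divisors// ?dvdn_gcdr//.
have g0 : (0 < gcdn d a)%N by rewrite gcdn_gt0 a0 orbT.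
rewrite -(@Gauss_dvdr _ (a %/ gcdn d a)).
  rewrite -(dvdn_pmul2l g0) mulnC divnK ?dvdn_gcdl// mulnA.
  by rewrite [(gcdn d a * _)%N]mulnC divnK ?dvdn_gcdr.
rewrite /coprime -(eqn_pmul2l g0) muln_gcdr muln1.
by rewrite ![(gcdn d a * _)%N]mulnC !divnK ?dvdn_gcdl ?dvdn_gcdr.
Qed.

Lemma tau_prime_expn p e : prime p -> (tau (p ^ e) <= e.+1)%N.
Proof.
move=> pp; rewrite -(size_mkseq (expn p) e.+1).
apply: uniq_leq_size; first exact: divisors_uniq.
move=> d; rewrite -dvdn_divisors ?expn_gt0 ?prime_gt0// => /(dvdn_pfactor _ _ pp).
by case=> i ie ->; apply/mapP; exists i => //; rewrite mem_iota.
Qed.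

(* Primes [p >= 2 ^ j] cost nothing, as then [(e + 1) ^ j <= 2 ^ (j * e) <= p ^ e];
   the finitely many smaller ones are removed one at a time. *)
Lemma tau_bound_rough j B : exists2 C : nat, (0 < C)%N &
  forall n, (0 < n)%N ->
    (forall p, prime p -> p %| n -> (p < B) || (2 ^ j <= p))%N ->
    (tau n ^ j <= C * n)%N.
Proof.
elim: B => [|B [C C0 IH]].
  (* At [B = 0] every prime factor is at least [2 ^ j]: splitting off one prime [p] multiplies [tau]
     by at most 2, hence [tau ^ j] by at most [2 ^ j <= p]. *)
  exists 1%N => // n; elim/ltn_ind: n => n IH n0 big; rewrite mul1n.
  have [n1|n1] := leqP n 1.
    have -> : n = 1%N by apply/eqP; rewrite eqn_leq n1.
    by rewrite exp1n.
  have pp := pdiv_prime n1.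
  have p0 := prime_gt0 pp.
  have /dvdnP[q qE] := pdiv_dvd n.
  move: (pdiv n) pp p0 qE (big _ pp (pdiv_dvd n)) => p pp p0 qE /= pj.
  have q0 : (0 < q)%N by move: n0; rewrite qE muln_gt0 => /andP[].
  have qn : (q < n)%N by rewrite qE ltn_Pmulr// prime_gt1.
  have tq := IH q qn q0 (fun r pr rq => big r pr (dvdn_trans rq _)).
  have {}tq := tq ltac:(by rewrite qE dvdn_mulr).
  rewrite mul1n in tq.
  rewrite qE mulnC (leq_trans _ (leq_mul pj tq))// -expnMn; apply: leq_expn2r.
  apply: leq_trans (divisors_mul_le _ _) _ => //.
  by rewrite leq_mul2r -[p]expn1 tau_prime_expn ?orbT.
(* Removing the full power [B ^ e'] from [n] costs [(e' + 1) ^ j <= c 2 ^ e' <= c B ^ e'], by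
   [succ_expn_le]. *)
pose c := (j`! * 2 ^ j)%N.
have [Bp|Bnp] := boolP (prime B); last first.
  exists C => // n n0 big; apply: IH => // p pp pn.
  have /orP[|->] := big p pp pn; last by rewrite orbT.
  rewrite ltnS leq_eqVlt => /orP[/eqP pB|->//].
  by move: Bnp; rewrite -pB pp.
exists (c * C)%N => [|n n0 big].
  by rewrite !muln_gt0 fact_gt0 expn_gt0 C0.
have [e ndvd nE] := pfactor_coprime Bp n0.
set e' := logn B n in nE.
have e0 : (0 < e)%N by move: n0; rewrite nE muln_gt0 => /andP[].
have te : (tau e ^ j <= C * e)%N.
  apply: IH => // p pp pe.
  have pn : (p %| n)%N by rewrite nE dvdn_mulr.
  have /orP[|->] := big p pp pn; last by rewrite orbT.
  rewrite ltnS leq_eqVlt => /orP[/eqP pB|->//].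
  by move: ndvd; rewrite prime_coprime// -pB pe.
have tB : (tau (B ^ e') ^ j <= c * B ^ e')%N.
  apply: (@leq_trans (e'.+1 ^ j)%N); first by rewrite leq_expn2r// tau_prime_expn.
  apply: leq_trans (succ_expn_le _ _) _.
  by rewrite leq_mul2l leq_expn2r ?orbT// prime_gt1.
rewrite nE.
have -> : (c * C * (e * B ^ e') = (C * e) * (c * B ^ e'))%N by lia.
apply: leq_trans (leq_mul te tB); rewrite -expnMn; apply: leq_expn2r.
by rewrite divisors_mul_le// expn_gt0 prime_gt0.
Qed.

(** The divisor bound [tau n = O(n ^ (1 / j))], written without real exponents. For [B = 2 ^ j] the
    condition on prime factors in [tau_bound_rough] holds for every prime. *)
Lemma tau_bound j : exists2 C : nat, (0 < C)%N &
  forall n, (0 < n)%N -> (tau n ^ j <= C * n)%N.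
Proof.
have [C C0 CP] := tau_bound_rough j (2 ^ j).
by exists C => // n n0; apply: CP => // p _ _; case: ltnP.
Qed.

(** Each dyadic block from [2 ^ t] to [2 ^ (t + 1)] has [2 ^ t] terms, none above [2 ^ (- t)], and
    so contributes at most 1. *)
Lemma harmonic_pow2 (R : realFieldType) t :
  \sum_(1 <= i < 2 ^ t) i%:R^-1 <= t%:R :> R.
Proof.
elim: t => [|t IH]; first by rewrite big_geq.
rewrite (@big_cat_nat _ _ _ (2 ^ t))/= ?expn_gt0 ?leq_pexp2l//.
rewrite -[in leRHS]natr1 lerD//.
have p0 : (0 : R) < (2 ^ t)%:R by rewrite ltr0n expn_gt0.
apply: (@le_trans _ _ (\sum_(2 ^ t <= i < 2 ^ t.+1) (2 ^ t)%:R^-1)).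
  apply: ler_sum_nat => i /andP[ti _].
  by rewrite lef_pV2 ?ler_nat// posrE ltr0n (leq_trans _ ti)// expn_gt0.
rewrite sumr_const_nat expnS mul2n -addnn addnK.
by rewrite -[leLHS]mulr_natr mulVf// gt_eqF.
Qed.

(** If [2 ^ t <= M < 2 ^ (t + 1)], the sum is at most [t + 1], and [succ_expn_le] bounds
    [(t + 1) ^ j] by a constant times [2 ^ t]. *)
Lemma harmonic_bound (R : realFieldType) j : exists2 C : nat, (0 < C)%N &
  forall M, (0 < M)%N ->
    (\sum_(1 <= i < M.+1) i%:R^-1) ^+ j <= (C * M)%:R :> R.
Proof.
exists (j`! * 2 ^ j)%N => [|M M0]; first by rewrite muln_gt0 fact_gt0 expn_gt0.
have /andP[tM Mt] := trunc_log_bounds (ltnSn 1) M0.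
move: (trunc_log 2 M) tM Mt => t tM Mt.
apply: (@le_trans _ _ (t.+1%:R ^+ j)).
  apply: lerXn2r; rewrite ?nnegrE ?ler0n//; first by apply: sumr_ge0 => i _.
  apply: le_trans (harmonic_pow2 _ _).
  rewrite [leRHS](@big_cat_nat _ _ _ M.+1)//= lerDl.
  by apply: sumr_ge0 => i _; rewrite invr_ge0.
rewrite -natrX ler_nat (leq_trans (succ_expn_le _ _))//.
by rewrite leq_mul.
Qed.

(** * Weighted counting by fibres, and Cauchy-Schwarz *)

Section SumFiber.
Variables (R : realFieldType) (T K E : eqType).

(** The counting device used throughout: [phi s] is a key that carries the weight, [psi s] a code
    that recovers [s] from its key. Since a key [k] admits at most [D] codes, it occurs at most [D]
    times. *)
Lemma sum_fiber (S : seq T) (phi : T -> K) (psi : T -> E) (L : seq K)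
    (F : K -> seq E) (w : K -> R) (D : R) :
  uniq S -> 0 <= D -> (forall k, 0 <= w k) ->
  {in S &, injective (fun s => (phi s, psi s))} ->
  {in S, forall s, [/\ phi s \in L, psi s \in F (phi s) &
                       (size (F (phi s)))%:R <= D]} ->
  \sum_(s <- S) w (phi s) <= D * \sum_(k <- L) w k.
Proof.
move=> uS D0 w0 inj hS.
(* Each [phi s] occurs in [L]; once the sums are exchanged, the coefficient of [w k] is the size of
   the fibre of [phi] over [k]. *)
apply: (@le_trans _ _ (\sum_(s <- S) \sum_(k <- L | k == phi s) w k)).
  rewrite big_seq [leRHS]big_seq; apply: ler_sum => s sS.
  have [sL _ _] := hS s sS.
  have sL' : phi s \in [seq k <- L | k == phi s] by rewrite mem_filter eqxx.
  rewrite -big_filter (perm_big _ (perm_to_rem sL'))/=.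
  by rewrite big_cons lerDl sumr_ge0.
rewrite (exchange_big_dep xpredT)//= mulr_sumr; apply: ler_sum => k _.
rewrite -big_filter big_const_seq count_predT iter_addr_0 -mulr_natl.
apply: ler_wpM2r => //.
have [->|] := eqVneq [seq s <- S | k == phi s] [::]; first by [].
case e : [seq s <- S | k == phi s] => [//|s0 r] _; rewrite -e.
have : s0 \in [seq s <- S | k == phi s] by rewrite e mem_head.
rewrite mem_filter => /andP[/eqP ks0 s0S].
have [_ _ szF] := hS s0 s0S; apply: le_trans szF.
rewrite -ks0 ler_nat -(size_map psi); apply: uniq_leq_size => [|y].
  rewrite map_inj_in_uniq ?filter_uniq// => s s'.
  rewrite !mem_filter => /andP[/eqP ks sS] /andP[/eqP ks' s'S] ps.
  by apply: inj => //; rewrite -ks -ks' ps.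
move=> /mapP[s]; rewrite mem_filter => /andP[/eqP -> sS] ->.
by have [] := hS s sS.
Qed.

(** Assuming [p ^ 2 <= q r] termwise avoids square roots. In the induction the cross term is handled
    by the inequality of arithmetic and geometric means. *)
Lemma cauchy_schwarz_seq (S : seq T) (p q r : T -> R) :
  {in S, forall s, [/\ 0 <= p s, 0 <= q s, 0 <= r s & p s ^+ 2 <= q s * r s]} ->
  (\sum_(s <- S) p s) ^+ 2 <= (\sum_(s <- S) q s) * (\sum_(s <- S) r s).
Proof.
elim: S => [|s S IH] h; first by rewrite !big_nil expr0n mulr0.
have [p0 q0 r0 pqr] := h s (mem_head _ _).
have hS : {in S, forall s, [/\ 0 <= p s, 0 <= q s, 0 <= r s & p s ^+ 2 <= q s * r s]}.
  by move=> x xS; apply: h; rewrite inE xS orbT.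
have {}IH := IH hS.
rewrite !big_cons.
have P0 : 0 <= \sum_(s <- S) p s.
  by rewrite big_seq sumr_ge0// => i /hS[].
have Q0 : 0 <= \sum_(s <- S) q s.
  by rewrite big_seq sumr_ge0// => i /hS[].
have R0 : 0 <= \sum_(s <- S) r s.
  by rewrite big_seq sumr_ge0// => i /hS[].
move: (p s) (q s) (r s) (\sum_(s <- S) p s) (\sum_(s <- S) q s)
  (\sum_(s <- S) r s) p0 q0 r0 pqr P0 Q0 R0 IH => a b c A B C a0 b0 c0 abc A0 B0 C0 ABC.
have h2 : 2 * (a * A) <= b * C + B * c.
  rewrite -ler_sqr ?nnegrE ?mulr_ge0 ?addr_ge0 ?mulr_ge0//.
  have : a ^+ 2 * A ^+ 2 <= (b * c) * (B * C).
    by apply: ler_pM => //; exact: sqr_ge0.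
  have := sqr_ge0 (b * C - B * c).
  nra.
nra.
Qed.

End SumFiber.

(** * A bilinear equation *)

Lemma dvdn_mul_gcd K M p : (K %| M * p -> K %| M * gcdn K p)%N.
Proof. by move=> KMp; rewrite muln_gcdr dvdn_gcd dvdn_mull. Qed.

(** The first entry [K] is [M X Y / d] for a solution of the equation below; the second, [w], is one
    of the two factors of [P K + A B]. *)
Definition bil_code P A B X Y := (P * X * Y - (A * X + B * Y), P * X - B)%N.

Definition bil_codes P A B M :=
  [seq (K, w) | K <- divisors (M * A * B), w <- divisors (P * K + A * B)].

(* [P = B / X + A / Y + M / d] with [X], [Y] coprime. The numerator [K] of [M / d]
   over the denominator [X * Y] can share with [X], [Y] only factors of [A], [B],
   and [(P * X - B) * (P * Y - A) = P * K + A * B]. *)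
Section Bilinear.
Variables P A B M : nat.
Hypotheses (A0 : (0 < A)%N) (B0 : (0 < B)%N) (M0 : (0 < M)%N).

Definition bil_sol X Y d := [/\ (0 < X)%N, (0 < Y)%N, (0 < d)%N, coprime X Y &
  (P * X * Y * d = (A * X + B * Y) * d + M * X * Y)%N].

Lemma bil_solE X Y d K w : bil_sol X Y d -> bil_code P A B X Y = (K, w) ->
  [/\ (K * d = M * X * Y)%N, (P * X * Y = K + (A * X + B * Y))%N,
      (P * X = w + B)%N, (0 < K)%N & (w * Y = K + A * X)%N].
Proof.
move=> [X0 Y0 d0 cop eq] [<- <-].
have le1 : (A * X + B * Y < P * X * Y)%N.
  by rewrite -(ltn_pmul2r d0) eq -[ltnLHS]addn0 ltn_add2l !muln_gt0 M0 X0.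
have le2 : (B < P * X)%N.
  rewrite -(ltn_pmul2r Y0); apply: leq_ltn_trans le1; exact: leq_addl.
have eK : (P * X * Y = (P * X * Y - (A * X + B * Y)) + (A * X + B * Y))%N.
  by rewrite subnK// ltnW.
have ew : (P * X = (P * X - B) + B)%N by rewrite subnK// ltnW.
split=> //; first by rewrite mulnBl eq addKn.
  by rewrite subn_gt0.
move: (P * X * Y - _)%N (P * X - B)%N eK ew => K' w' eK ew.
by apply: (@addIn (B * Y)); rewrite -mulnDl -ew eK addnA.
Qed.

Lemma mem_bil_codes X Y d : bil_sol X Y d ->
  bil_code P A B X Y \in bil_codes P A B M.
Proof.
move=> sol; case E : (bil_code P A B X Y) => [K w].
have [Kd PXY PX K0 wY] := bil_solE sol E; case: sol => X0 Y0 d0 cop eq.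
apply: allpairs_f_dep; rewrite -dvdn_divisors ?addn_gt0 ?muln_gt0 ?A0 ?B0 ?M0 ?orbT//.
  (* [gcd (K, X)] divides [B Y], because [P X Y = K + A X + B Y], and it is coprime to [Y]. *)
  have KX : (gcdn K X %| B)%N.
    have cXY : coprime (gcdn K X) Y by exact: coprime_dvdl (dvdn_gcdr _ _) cop.
    rewrite -(Gauss_dvdl _ cXY) -(dvdn_addr _ (_ : _ %| A * X)%N) ?dvdn_mull ?dvdn_gcdr//.
    rewrite -(dvdn_addr _ (dvdn_gcdl K X)) -PXY.
    by rewrite -mulnA dvdn_mull// dvdn_mulr// dvdn_gcdr.
  have KY : (gcdn K Y %| A)%N.
    have cXY : coprime (gcdn K Y) X.
      by apply: coprime_dvdl (dvdn_gcdr _ _) _; rewrite coprime_sym.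
    rewrite -(Gauss_dvdl _ cXY) -(dvdn_addl _ (_ : _ %| B * Y)%N) ?dvdn_mull ?dvdn_gcdr//.
    rewrite -(dvdn_addr _ (dvdn_gcdl K Y)) -PXY.
    by rewrite dvdn_mull// dvdn_gcdr.
  have : (K %| M * X * Y)%N by rewrite -Kd dvdn_mulr.
  move/dvdn_mul_gcd; rewrite mulnAC => /dvdn_mul_gcd KM.
  by apply: dvdn_trans KM _; rewrite dvdn_mul// dvdn_mul.
apply/dvdnP; exists (P * Y - A)%N.
have AY : (A <= P * Y)%N.
  rewrite -(leq_pmul2r X0) mulnAC PXY (leq_trans (leq_addr (B * Y) _))//.
  exact: leq_addl.
have {}AY : (P * Y = (P * Y - A) + A)%N by rewrite subnK.
move: (P * Y - A)%N AY => w' PY.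
have : ((w + B) * (w' + A) = P * (K + (A * X + B * Y)))%N.
  by rewrite -PX -PY -PXY; ring.
have -> : (P * (K + (A * X + B * Y)) = P * K + A * (w + B) + B * (w' + A))%N.
  by rewrite -PX -PY; ring.
lia.
Qed.

(** From [(K, w)] one recovers [X] by [P X = w + B], then [Y] by [w Y = K + A X], then [d] by
    [K d = M X Y]. *)
Lemma bil_code_inj X Y d X' Y' d' : bil_sol X Y d -> bil_sol X' Y' d' ->
  bil_code P A B X Y = bil_code P A B X' Y' -> (0 < P)%N ->
  [/\ X = X', Y = Y' & d = d'].
Proof.
move=> sol sol' ee P0.
case E : (bil_code P A B X Y) => [K w].
have [Kd PXY PX K0 wY] := bil_solE sol E.
have [Kd' PXY' PX' K0' wY'] := bil_solE sol' (etrans (esym ee) E).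
have XX : X = X' by apply/eqP; rewrite -(eqn_pmul2l P0) PX PX'.
subst X'.
have w0 : (0 < w)%N.
  rewrite lt0n; apply/eqP => w0; move: wY; rewrite w0 => /esym/eqP.
  by rewrite mul0n addn_eq0 => /andP[/eqP K00 _]; move: K0; rewrite K00.
have YY : Y = Y' by apply/eqP; rewrite -(eqn_pmul2l w0) wY wY'.
by subst Y'; split=> //; apply/eqP; rewrite -(eqn_pmul2l K0) Kd Kd'.
Qed.

End Bilinear.

Lemma size_allpairs_dep_le (R : realFieldType) (T E V : eqType) (f : T -> E -> V)
    (s : seq T) (t : T -> seq E) (p q : R) : 0 <= q ->
  (size s)%:R <= p -> {in s, forall x, (size (t x))%:R <= q} ->
  (size [seq f x y | x <- s, y <- t x])%:R <= p * q.
Proof.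
move=> q0 sp tq; apply: le_trans (ler_wpM2r q0 sp).
elim: s tq {sp} => [|x s IH] tq; first by rewrite mul0r.
rewrite /= size_cat size_map natrD -nat1r mulrDl mul1r lerD ?tq ?mem_head//.
by apply: IH => y ys; rewrite tq// inE ys orbT.
Qed.

(** Both numbers whose divisors are listed, [M A B] and [P K + A B] with [K <= M A B], are at most
    [2 P M A B]. *)
Lemma size_bil_codes (R : realFieldType) P A B M (Q : R) (z : nat) : 1 <= Q ->
  (forall x, (0 < x <= z)%N -> (tau x)%:R <= Q) ->
  (0 < A)%N -> (0 < B)%N -> (0 < M)%N -> (0 < P)%N -> (2 * (P * M * A * B) <= z)%N ->
  (size (bil_codes P A B M))%:R <= Q ^+ 2.
Proof.
move=> Q1 tQ A0 B0 M0 P0 Pz; rewrite expr2.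
have Q0 : 0 <= Q by exact: le_trans Q1.
apply: size_allpairs_dep_le => //.
  apply: tQ; rewrite !muln_gt0 M0 A0 B0; apply: leq_trans Pz.
  have -> : (2 * (P * M * A * B) = (2 * P) * (M * A * B))%N by ring.
  by rewrite leq_pmull// muln_gt0.
move=> K; rewrite -dvdn_divisors ?muln_gt0 ?M0 ?A0// => /dvdn_leq K1.
have {}K1 : (K <= M * A * B)%N by apply: K1; rewrite !muln_gt0 M0 A0 B0.
apply: tQ; rewrite addn_gt0 !muln_gt0 A0 B0 orbT/=; apply: leq_trans Pz.
rewrite mul2n -addnn leq_add//.
  have -> : (P * M * A * B = P * (M * A * B))%N by ring.
  by rewrite leq_mul2l K1 orbT.
have -> : (P * M * A * B = (P * M) * (A * B))%N by ring.
by rewrite leq_pmull// muln_gt0 P0.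
Qed.

(** * Sums of four unit fractions *)

(** The equation reads [m / n = 1 / a + Y / X], where [0 < Y / X <= k / a]; the remainder [Y / X]
    equals [(m a - n) / (n a)]. *)
Lemma subtract_unit_fraction m n a k X Y :
  (0 < n)%N -> (0 < a)%N -> (0 < X)%N -> (0 < Y)%N ->
  (a * Y <= k * X)%N -> (m * a * X = n * X + n * a * Y)%N ->
  [/\ (n < m * a)%N, (m * a <= k.+1 * n)%N & ((m * a - n) * X = n * a * Y)%N].
Proof.
move=> n0 a0 X0 Y0 le eq; split.
- by rewrite -(ltn_pmul2r X0) eq -[ltnLHS]addn0 ltn_add2l !muln_gt0 n0 a0.
- rewrite -(leq_pmul2r X0) eq mulSn mulnDl leq_add2l -mulnA.
  by rewrite [(k * n)%N]mulnC -mulnA leq_mul2l le orbT.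
- by rewrite mulnBl eq addKn.
Qed.

(** The equation [m / n = 1 / a + 1 / b + 1 / c + 1 / d], cleared of denominators. *)
Definition sol4 m n a b c d := [/\ (0 < a)%N, (a <= b)%N, (b <= c)%N, (c <= d)%N &
  (m * a * b * c * d = n * (b * c * d + a * c * d + a * b * d + a * b * c))%N].

Section Sol4.
Variables m n a b c d : nat.
Hypotheses (n0 : (0 < n)%N) (sol : sol4 m n a b c d).

Let u := (m * a - n)%N.
Let N := (n * a)%N.
Let v := (u * b - N)%N.

Lemma sol4_gt0 : [/\ (0 < a)%N, (0 < b)%N, (0 < c)%N & (0 < d)%N].
Proof.
have [a0 ab bc cd _] := sol; split=> //.
- exact: leq_trans ab.
- exact: leq_trans (leq_trans ab bc).
- exact: leq_trans (leq_trans (leq_trans ab bc) cd).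
Qed.

(** This and the next two lemmas subtract [1 / a], [1 / b], [1 / c] in turn, leaving [u / N], then
    [v / (N b)], then [(v c - N b) / (N b c) = 1 / d]. The factors 4, 3, 2 count the terms still
    present, of which the first is the largest. *)
Lemma sol4_step1 : [/\ (n < m * a)%N, (m * a <= 4 * n)%N &
  (u * (b * c * d) = N * (c * d + b * d + b * c))%N].
Proof.
have [a0 b0 c0 d0] := sol4_gt0; have [_ ab bc cd eq] := sol.
apply: (@subtract_unit_fraction _ _ _ 3) => //;
  rewrite ?muln_gt0 ?addn_gt0 ?muln_gt0 ?c0 ?d0 ?b0//.
  rewrite !mulSn mul0n addn0 !mulnDr !addnA !mulnA.
  have h1 : (a * c * d <= b * c * d)%N by rewrite !leq_mul.
  have h2 : (a * b * d <= b * c * d)%N.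
    by rewrite leq_mul2r mulnC leq_mul ?orbT// (leq_trans ab bc).
  have h3 : (a * b * c <= b * c * d)%N.
    rewrite -mulnA mulnC leq_mul//; exact: leq_trans (leq_trans ab bc) cd.
  by rewrite !leq_add.
by rewrite !mulnA eq /N; ring.
Qed.

Lemma sol4_step2 : [/\ (N < u * b)%N, (u * b <= 3 * N)%N &
  (v * (c * d) = N * b * (c + d))%N].
Proof.
have [a0 b0 c0 d0] := sol4_gt0; have [_ ab bc cd _] := sol.
have [_ _ eq] := sol4_step1.
apply: (@subtract_unit_fraction _ _ _ 2) => //;
  rewrite ?muln_gt0 ?addn_gt0 ?muln_gt0 ?c0 ?d0 ?b0 ?n0//.
  rewrite !mulSn mul0n addn0 mulnDr addnC leq_add//.
    by rewrite leq_mul// (leq_trans bc cd).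
  by rewrite leq_mul.
have -> : (u * b * (c * d) = u * (b * c * d))%N by ring.
by rewrite eq; ring.
Qed.

Lemma sol4_step3 : [/\ (N * b < v * c)%N, (v * c <= 2 * (N * b))%N &
  ((v * c - N * b) * d = N * b * c)%N].
Proof.
have [a0 b0 c0 d0] := sol4_gt0; have [_ ab bc cd _] := sol.
have [_ _ eq] := sol4_step2.
have h := @subtract_unit_fraction v (N * b) c 1 d 1.
rewrite !muln1 mul1n in h.
apply: h => //; first by rewrite !muln_gt0 n0 a0.
by rewrite -mulnA eq; ring.
Qed.

Let G := gcdn b c.
Let x := (b %/ G)%N.
Let y := (c %/ G)%N.
Let h := gcdn a G.
Let g := (G %/ h)%N.
Let a' := (a %/ h)%N.

Lemma sol4_gcd : [/\ b = (h * g * x)%N, c = (h * g * y)%N, a = (h * a')%N &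
  G = (h * g)%N].
Proof.
have GE : G = (h * g)%N by rewrite mulnC divnK// dvdn_gcdr.
split=> //.
- by rewrite -GE mulnC divnK// dvdn_gcdl.
- by rewrite -GE mulnC divnK// dvdn_gcdr.
- by rewrite mulnC divnK// dvdn_gcdl.
Qed.

Lemma sol4_gcd_gt0 : [/\ (0 < h)%N, (0 < g)%N, (0 < x)%N, (0 < y)%N & (0 < a')%N].
Proof.
have [a0 b0 c0 d0] := sol4_gt0; have [bE cE aE GE] := sol4_gcd.
move: a0 b0 c0; rewrite bE cE aE !muln_gt0.
by move=> /andP[-> ->] /andP[/andP[_ ->] ->] /andP[_ ->].
Qed.

Lemma sol4_coprime : coprime x y /\ coprime a' g.
Proof.
have [a0 b0 c0 d0] := sol4_gt0; have [bE cE aE GE] := sol4_gcd.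
have [h0 g0 _ _ _] := sol4_gcd_gt0.
split.
  have G0 : (0 < G)%N by rewrite GE muln_gt0 h0.
  by rewrite /coprime -(eqn_pmul2l G0) muln_gcdr muln1 GE -bE -cE -GE.
by rewrite /coprime -(eqn_pmul2l h0) muln_gcdr muln1 -aE -GE.
Qed.

(** This is [u / N = 1 / b + 1 / c + 1 / d] multiplied by [N G]. The coefficients depend on
    [(a, h, g)] only, so that this key leaves few choices of [(x, y, d)]. *)
Lemma sol4_bilA : bil_sol (u * (h * g)) N N (N * (h * g)) x y d.
Proof.
have [a0 b0 c0 d0] := sol4_gt0; have [bE cE aE GE] := sol4_gcd.
have [h0 g0 x0 y0 _] := sol4_gcd_gt0; have [cxy _] := sol4_coprime.
split=> //; have [_ _] := sol4_step1; rewrite bE cE => eq.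
have G0 : (0 < h * g)%N by rewrite muln_gt0 h0.
apply/eqP; rewrite -(eqn_pmul2l G0); apply/eqP.
have -> : (h * g * (u * (h * g) * x * y * d) =
           u * (h * g * x * (h * g * y) * d))%N by ring.
by rewrite eq; ring.
Qed.

(** This is the original equation multiplied by [n h x y]. The coefficients depend on [(x, y, h)]
    only, and the coprime unknowns are [a'] and [g]. *)
Lemma sol4_bilB : bil_sol (m * h * x * y) (n * (x + y)) (n * x * y)
  (n * h * x * y) a' g d.
Proof.
have [a0 b0 c0 d0] := sol4_gt0; have [bE cE aE GE] := sol4_gcd.
have [h0 g0 x0 y0 a'0] := sol4_gcd_gt0; have [_ cag] := sol4_coprime.
split=> //; have [_ _ _ _] := sol; rewrite bE cE aE => eq.
have G0 : (0 < h * h * g)%N by rewrite !muln_gt0 h0.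
apply/eqP; rewrite -(eqn_pmul2l G0); apply/eqP.
have -> : (h * h * g * (m * h * x * y * a' * g * d) =
           m * (h * a') * (h * g * x) * (h * g * y) * d)%N by ring.
by rewrite eq; ring.
Qed.

(** [v / (N b) = 1 / c + 1 / d] is equivalent to [(v c - N b) (v d - N b) = (N b) ^ 2]. *)
Lemma sol4_codeC : (v * c - N * b)%N \in divisors ((N * b) ^ 2).
Proof.
have [a0 b0 c0 d0] := sol4_gt0.
have [_ _ eq2] := sol4_step2; have [lt _ eq] := sol4_step3.
have N0 : (0 < N * b)%N by rewrite !muln_gt0 n0 a0.
rewrite -dvdn_divisors ?expn_gt0 ?N0//; apply/dvdnP; exists (v * d - N * b)%N.
have le : (N * b <= v * d)%N.
  rewrite -(leq_pmul2r c0); have -> : (v * d * c = v * (c * d))%N by ring.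
  by rewrite eq2 leq_mul2l leq_addr orbT.
have {}le : (v * d = (v * d - N * b) + N * b)%N by rewrite subnK.
have e1 : (v * c = (v * c - N * b) + N * b)%N by rewrite subnK// ltnW.
have := eq; move: (v * c - N * b)%N e1 => w e1 wd.
move: (v * d - N * b)%N le => w' le.
have : (w * (v * d) = N * b * (v * c))%N by rewrite mulnCA wd; ring.
rewrite le e1 => e; rewrite -mulnn.
by apply: (@addIn (w * (N * b))); rewrite [(w' * w)%N]mulnC -mulnDr e; ring.
Qed.

(** Since [b c = h (g ^ 2 x y h)], the left side is at most [u ^ 2 b (v c)]. Now [v c <= 2 N b] and
    [u b <= 3 N] give [2 N (3 N) ^ 2]. *)
Lemma sol4_weight : (g ^ 2 * u ^ 2 * (x * y * h) * v <= 18 * N ^ 3)%N.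
Proof.
have [a0 b0 c0 d0] := sol4_gt0; have [bE cE aE GE] := sol4_gcd.
have [h0 g0 _ _ _] := sol4_gcd_gt0.
have [_ ub _] := sol4_step2; have [_ vc _] := sol4_step3.
apply: (@leq_trans (u ^ 2 * b * (v * c))%N).
  rewrite bE cE.
  have -> : (u ^ 2 * (h * g * x) * (v * (h * g * y)) =
             h * (g ^ 2 * u ^ 2 * (x * y * h) * v))%N by ring.
  by rewrite leq_pmull.
apply: (@leq_trans (u ^ 2 * b * (2 * (N * b)))%N); first by rewrite leq_mul2l vc orbT.
have -> : (u ^ 2 * b * (2 * (N * b)) = 2 * N * (u * b) ^ 2)%N by ring.
have -> : (18 * N ^ 3 = 2 * N * (3 * N) ^ 2)%N by ring.
by rewrite leq_mul2l leq_expn2r ?orbT.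
Qed.

End Sol4.

(** The range of the least of [k] denominators: [1 / a < m / n <= k / a]. The cut-off at [k n] loses
    nothing, as [n < m a] forces [m > 0]. *)
Definition firsts k m n := [seq a <- iota 0 (k * n).+1 | (n < m * a <= k * n)%N].

Lemma mem_firsts k m n a : (a \in firsts k m n) = (n < m * a <= k * n)%N.
Proof.
rewrite mem_filter mem_iota add0n ltnS leq0n/=.
case: (ltnP n (m * a)) => //= nma; case: (leqP (m * a) (k * n)) => //= mak.
apply: leq_trans mak; rewrite leq_pmull//.
by case: m nma => //; rewrite mul0n ltn0.
Qed.

Lemma firsts_uniq k m n : uniq (firsts k m n).
Proof. exact/filter_uniq/iota_uniq. Qed.

Lemma le_powM z i j k x y : (0 < z)%N -> (i + j <= k)%N ->
  (x <= z ^ i)%N -> (y <= z ^ j)%N -> (x * y <= z ^ k)%N.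
Proof.
move=> z0 ijk xz yz; apply: leq_trans (leq_mul xz yz) _.
by rewrite -expnD leq_pexp2l.
Qed.

(** * All parameters are bounded by powers of [z] *)

Section Sol4Size.
Variables m n a b c d z : nat.
Hypotheses (n0 : (0 < n)%N) (nz : (4 * n <= z)%N) (sol : sol4 m n a b c d).

Let u := (m * a - n)%N.
Let N := (n * a)%N.
Let v := (u * b - N)%N.
Let G := gcdn b c.
Let x := (b %/ G)%N.
Let y := (c %/ G)%N.
Let h := gcdn a G.
Let g := (G %/ h)%N.

Lemma sol4_pos : [/\ (0 < m)%N, (0 < u)%N, (0 < N)%N & (0 < v)%N].
Proof.
have [a0 _ _ _] := sol4_gt0 sol.
have [nma _ _] := sol4_step1 n0 sol; have [Nub _ _] := sol4_step2 n0 sol.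
split; rewrite ?subn_gt0// ?muln_gt0 ?n0//.
by case: m nma => //; rewrite mul0n ltn0.
Qed.

Lemma sol4_size : [/\ (4 <= z)%N, (m <= z)%N & (a <= z)%N] /\
  [/\ (u <= z)%N, (N <= z ^ 2)%N, (b <= z ^ 2)%N, (v <= z ^ 2)%N & (c <= z ^ 4)%N].
Proof.
have [a0 b0 c0 _] := sol4_gt0 sol; have [m0 u0 N0 v0] := sol4_pos.
have [_ ma _] := sol4_step1 n0 sol.
have [_ ub _] := sol4_step2 n0 sol; have [_ vc _] := sol4_step3 n0 sol.
have z4 : (4 <= z)%N by apply: leq_trans nz; rewrite leq_pmulr.
have maz : (m * a <= z)%N by exact: leq_trans ma nz.
have az : (a <= z)%N by rewrite (leq_trans _ maz)// leq_pmull.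
have ubz : (u * b <= z ^ 2)%N.
  rewrite (leq_trans ub)// /N mulnA -mulnn leq_mul//.
  by apply: leq_trans nz; rewrite leq_mul2r orbT.
have bz : (b <= z ^ 2)%N by rewrite (leq_trans _ ubz)// leq_pmull.
split; split=> //.
- by rewrite (leq_trans _ maz)// leq_pmulr.
- by rewrite (leq_trans _ maz)// leq_subr.
- rewrite /N -mulnn leq_mul// (leq_trans _ nz)// leq_pmull//.
- by rewrite (leq_trans _ ubz)// leq_subr.
- apply: (@leq_trans (2 * (N * b))%N); first by rewrite (leq_trans _ vc)// leq_pmull.
  have -> : (2 * (N * b) = (2 * n) * (a * b))%N by rewrite /N; ring.
  apply: (@le_powM _ 1 3) => //; first by rewrite (leq_trans _ z4).
    by rewrite expn1 (leq_trans _ nz)// leq_mul2r orbT.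
  by apply: (@le_powM _ 1 2) => //; rewrite (leq_trans _ z4).
Qed.

Lemma sol4_gcd_size : [/\ (h <= z)%N, (h * g <= z ^ 2)%N, (g <= z ^ 2)%N,
  (x <= z ^ 2)%N & (y <= z ^ 4)%N].
Proof.
have [a0 b0 c0 _] := sol4_gt0 sol; have [bE cE aE GE] := sol4_gcd a b c.
have [h0 g0 x0 y0 _] := sol4_gcd_gt0 sol.
have [[_ _ az] [_ _ bz _ cz]] := sol4_size.
split.
- by apply: leq_trans az; rewrite dvdn_leq// dvdn_gcdl.
- by rewrite -GE (leq_trans _ bz)// dvdn_leq// dvdn_gcdl.
- by apply: leq_trans bz; rewrite {1}bE mulnAC leq_pmull// muln_gt0 h0.
- by apply: leq_trans bz; rewrite {1}bE leq_pmull// muln_gt0 h0.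
- by apply: leq_trans cz; rewrite {1}cE leq_pmull// muln_gt0 h0.
Qed.

Lemma sol4_sizeA : (2 * (u * (h * g) * (N * (h * g)) * N * N) <= z ^ 30)%N.
Proof.
have [[z4 _ _] [uz Nz _ _ _]] := sol4_size; have [_ hgz _ _ _] := sol4_gcd_size.
have z0 : (0 < z)%N by exact: leq_trans z4.
apply: (@le_powM _ 1 11) => //; first by rewrite expn1 (leq_trans _ z4).
apply: (@le_powM _ 9 2) => //; apply: (@le_powM _ 7 2) => //.
by apply: (@le_powM _ 3 4) => //; [apply: (@le_powM _ 1 2)|apply: (@le_powM _ 2 2)].
Qed.

(** The exponent 30 originates here: the factor 2 and the four arguments of the code take the
    exponents 1, 8, 8, 6 and 7. *)
Lemma sol4_sizeB : (2 * (m * h * x * y * (n * h * x * y) * (n * (x + y)) *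
  (n * x * y)) <= z ^ 30)%N.
Proof.
have [[z4 mz _] _] := sol4_size; have [hz _ _ xz yz] := sol4_gcd_size.
have z0 : (0 < z)%N by exact: leq_trans z4.
have nz' : (n <= z ^ 1)%N by rewrite expn1 (leq_trans _ nz)// leq_pmull.
have xyz : (x + y <= z ^ 5)%N.
  rewrite (expnS _ 4); apply: (@leq_trans (2 * z ^ 4)%N); last first.
    by rewrite leq_mul2r (leq_trans _ z4) ?orbT.
  by rewrite mul2n -addnn leq_add// (leq_trans xz)// leq_pexp2l.
apply: (@le_powM _ 1 29) => //; first by rewrite expn1 (leq_trans _ z4).
apply: (@le_powM _ 22 7) => //; last first.
  by apply: (@le_powM _ 3 4) => //; apply: (@le_powM _ 1 2).
apply: (@le_powM _ 16 6) => //; last by apply: (@le_powM _ 1 5).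
by apply: (@le_powM _ 8 8) => //; apply: (@le_powM _ 4 4) => //;
   apply: (@le_powM _ 2 2) => //; apply: (@le_powM _ 1 1).
Qed.

End Sol4Size.

(** * Three weighted sums over the solutions, and the bound for four terms *)

Section FourTerms.
Variables (R : realFieldType) (Q : R) (z : nat).
Hypothesis Q1 : 1 <= Q.
Hypothesis tQ : forall x, (0 < x <= z ^ 30)%N -> (tau x)%:R <= Q.
Hypothesis hQ : \sum_(1 <= i < (z ^ 30).+1) i%:R^-1 <= Q.

Let Q0 : 0 <= Q. Proof. exact: le_trans Q1. Qed.

Definition sigma m n : R := \sum_(a <- firsts 4 m n) (m * a - n)%:R^-1.

Lemma sigma_ge0 m n : 0 <= sigma m n.
Proof. by apply: sumr_ge0 => i _; rewrite invr_ge0. Qed.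

(** The left side is the sum of [1 / v] over pairs [(a, b)]. From [u (m b - n) = m v + n ^ 2], a
    given [v] leaves at most [Q] values of [u], and [(u, v)] determines [(a, b)]; the harmonic sum
    over [v] gives the second factor [Q]. *)
Lemma sum_sigma_le m n : (0 < n)%N -> (4 * n <= z)%N ->
  \sum_(a <- firsts 5 m n) sigma (m * a - n) (n * a) <= Q ^+ 2.
Proof.
move=> n0 nz.
pose S := [seq (a, b) | a <- firsts 5 m n, b <- firsts 4 (m * a - n) (n * a)].
pose phi (s : nat * nat) := ((m * s.1 - n) * s.2 - n * s.1)%N.
pose psi (s : nat * nat) := (m * s.1 - n)%N.
have -> : \sum_(a <- firsts 5 m n) sigma (m * a - n) (n * a) =
    \sum_(s <- S) (phi s)%:R^-1 by rewrite /S big_allpairs_dep.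
apply: (@le_trans _ _ (Q * \sum_(k <- index_iota 1 (z ^ 30).+1) k%:R^-1)); last first.
  by rewrite expr2 ler_wpM2l.
have hS a b : (a, b) \in S -> [/\ (n < m * a)%N, (m * a <= 5 * n)%N,
    (n * a < (m * a - n) * b)%N & ((m * a - n) * b <= 4 * (n * a))%N].
  by move=> /allpairsPdep[x [y [+ + [-> ->]]]]; rewrite !mem_firsts => /andP[? ?] /andP[].
apply: (@sum_fiber _ _ _ _ S phi psi _ (fun v => divisors (m * v + n ^ 2))
  (fun k => k%:R^-1)) => //.
- apply: allpairs_uniq_dep => [|a _|]; [exact: firsts_uniq|exact: firsts_uniq|].
  by move=> [a b] [a' b'] _ _ /= [-> ->].
- move=> [a b] [a2 b2] /hS[h1 _ h2 _] /hS[h1' _ h2' _].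
  rewrite /phi /psi/= => -[vv uu].
  have /andP[m0 _] : (0 < m)%N && (0 < a)%N by rewrite -muln_gt0 (leq_ltn_trans _ h1).
  have aa : a = a2.
    apply/eqP; rewrite -(eqn_pmul2l m0); apply/eqP.
    by rewrite -(subnK (ltnW h1)) -(subnK (ltnW h1')) uu.
  subst a2; congr pair.
  have u0 : (0 < m * a - n)%N by rewrite subn_gt0.
  apply/eqP; rewrite -(eqn_pmul2l u0); apply/eqP.
  by rewrite -(subnK (ltnW h2)) -(subnK (ltnW h2')) vv.
- move=> [a b] /hS[h1 h1' h2 h2']; rewrite /phi /psi/=.
  have /andP[m0 a0] : (0 < m)%N && (0 < a)%N by rewrite -muln_gt0 (leq_ltn_trans _ h1).
  have v0 : (0 < (m * a - n) * b - n * a)%N by rewrite subn_gt0.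
  have z4 : (4 <= z)%N by apply: leq_trans nz; rewrite leq_pmulr.
  have z0 : (0 < z)%N by exact: leq_trans z4.
  have nz1 : (n <= z)%N by rewrite (leq_trans _ nz)// leq_pmull.
  have z2 : (5 * n <= z ^ 2)%N.
    by rewrite -mulnn (leq_trans _ (leq_mul z4 nz))// mulnA leq_mul2r orbT.
  have az : (a <= z ^ 2)%N.
    by apply: leq_trans z2; rewrite (leq_trans _ h1')// leq_pmull.
  have mz : (m <= z ^ 2)%N.
    by apply: leq_trans z2; rewrite (leq_trans _ h1')// leq_pmulr.
  have vz : ((m * a - n) * b - n * a <= z ^ 3)%N.
    rewrite (leq_trans (leq_subr _ _))// (leq_trans h2')// mulnA.
    by apply: (@le_powM _ 1 2) => //; rewrite expn1.
  have Fz : (m * ((m * a - n) * b - n * a) + n ^ 2 <= z ^ 30)%N.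
    apply: (@leq_trans (z * z ^ 5)%N); last by rewrite -expnS leq_pexp2l.
    apply: (@leq_trans (2 * z ^ 5)%N); last by rewrite leq_mul2r (leq_trans _ z4) ?orbT.
    rewrite mul2n -addnn leq_add//; first exact: (@le_powM _ 2 3).
    by rewrite (leq_trans (leq_expn2r _ nz1))// leq_pexp2l.
  split.
  + rewrite mem_index_iota v0 ltnS/=; apply: leq_trans vz _.
    by rewrite leq_pexp2l.
  + rewrite -dvdn_divisors ?addn_gt0 ?expn_gt0 ?n0 ?orbT//.
    apply/dvdnP; exists (m * b - n)%N.
    have e1 : (m * a = (m * a - n) + n)%N by rewrite subnK// ltnW.
    have e2 : ((m * a - n) * b = ((m * a - n) * b - n * a) + n * a)%N.
      by rewrite subnK// ltnW.
    have : (0 < m * a - n)%N by rewrite subn_gt0.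
    move: (m * a - n)%N e1 e2 => u e1 + u0; move: (u * b - n * a)%N => v e2.
    rewrite mulnBl; apply: (@addIn (n * u)); rewrite subnK.
      have -> : (m * b * u = m * (u * b))%N by ring.
      rewrite e2.
      have -> : (m * (v + n * a) = m * v + n * (m * a))%N by ring.
      by rewrite e1; ring.
    rewrite leq_mul2r; apply/orP; right.
    have : (n * u <= m * b * u)%N.
      have -> : (m * b * u = m * (u * b))%N by ring.
      rewrite e2.
      have -> : (m * (v + n * a) = m * v + n * (m * a))%N by ring.
      rewrite e1 mulnDr addnA [X in (_ <= X + _)%N]addnC -addnA; exact: leq_addr.
    by rewrite leq_pmul2r.
  + by apply: tQ; rewrite addn_gt0 expn_gt0 n0 orbT.
Qed.

Variables m n : nat.
Hypotheses (n0 : (0 < n)%N) (nz : (4 * n <= z)%N).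
Variable S : seq (nat * nat * nat * nat).
Hypothesis uS : uniq S.
Hypothesis hS : forall a b c d, (a, b, c, d) \in S -> sol4 m n a b c d.

(** The key is [(a, h, g)], with at most [Q ^ 2] codes from [sol4_bilA]. Summing over the divisors
    [h] of [a] and over [g] costs a factor [Q] each; the sum over [a] is [sigma]. *)
Lemma sum_inv_gu_le : \sum_(s <- S) (let: (a, b, c, d) := s in let G := gcdn b c in
    ((G %/ gcdn a G) * (m * a - n))%:R^-1) <= Q ^+ 4 * sigma m n :> R.
Proof.
pose phi (s : nat * nat * nat * nat) := let: (a, b, c, d) := s in
  let G := gcdn b c in let h := gcdn a G in (a, (h, G %/ h))%N.
pose psi (s : nat * nat * nat * nat) := let: (a, b, c, d) := s in
  let G := gcdn b c in let N := (n * a)%N in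
  bil_code ((m * a - n) * G) N N (b %/ G) (c %/ G).
pose w (k : nat * (nat * nat)) : R := (k.2.2 * (m * k.1 - n))%:R^-1.
pose F (k : nat * (nat * nat)) := let: (a, (h, g)) := k in let N := (n * a)%N in
  bil_codes ((m * a - n) * (h * g)) N N (N * (h * g)).
pose L := [seq (a, hg) | a <- firsts 4 m n,
  hg <- [seq (h, g) | h <- divisors a, g <- index_iota 1 (z ^ 30).+1]].
apply: (@le_trans _ _ (\sum_(s <- S) w (phi s))).
  by apply: ler_sum => -[[[a b] c] d].
apply: (@le_trans _ _ (Q ^+ 2 * \sum_(k <- L) w k)); last first.
  rewrite (exprD Q 2 2) -mulrA ler_wpM2l ?exprn_ge0//.
  rewrite /L big_allpairs_dep/= /sigma mulr_sumr big_seq [leRHS]big_seq.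
  apply: ler_sum => a; rewrite mem_firsts => /andP[nma man].
  have a0 : (0 < a)%N by case: a nma {man} => //; rewrite muln0 ltn0.
  have m0 : (0 < m)%N by case: m nma {man} => //; rewrite mul0n ltn0.
  have z0 : (0 < z)%N by rewrite (leq_trans _ nz)// muln_gt0.
  have az : (a <= z ^ 30)%N.
    have man' : (a <= z ^ 1)%N.
      by rewrite expn1 (leq_trans _ nz)// (leq_trans _ man)// leq_pmull.
    by apply: leq_trans man' _; rewrite leq_pexp2l.
  rewrite big_allpairs_dep/= /w/=.
  under eq_bigr do under eq_bigr do rewrite natrM invfM.
  under eq_bigr do rewrite -mulr_suml.
  rewrite big_const_seq count_predT iter_addr_0 -[leLHS]mulr_natl.
  rewrite mulrA ler_wpM2r ?invr_ge0//.
  rewrite expr2; apply: ler_pM => //; last by rewrite tQ// a0.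
  by apply: sumr_ge0 => i _; rewrite invr_ge0.
apply: (@sum_fiber _ _ _ _ S phi psi L F w).
- by [].
- exact: exprn_ge0.
- by move=> k; rewrite invr_ge0.
- move=> [[[a b] c] d] [[[a2 b2] c2] d2] sS sS2; move: (hS sS) (hS sS2) => sol sol2.
  rewrite /phi /psi/= => -[aa hh gg cc1 cc2]; subst a2.
  have [bE cE aE GE] := sol4_gcd a b c; have [bE2 cE2 aE2 GE2] := sol4_gcd a b2 c2.
  have GG : gcdn b c = gcdn b2 c2 by rewrite GE GE2 -hh gg -hh.
  have A := sol4_bilA n0 sol; have A2 := sol4_bilA n0 sol2.
  have [_ u0 N0 _] := sol4_pos n0 sol.
  have [h0 g0 x0 y0 _] := sol4_gcd_gt0 sol.
  rewrite -GE in A; rewrite -GE2 -GG in A2.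
  have G0 : (0 < gcdn b c)%N by rewrite GE muln_gt0 h0.
  have M0 : (0 < n * a * gcdn b c)%N by rewrite muln_gt0 N0.
  have P0 : (0 < (m * a - n) * gcdn b c)%N by rewrite muln_gt0 u0.
  have cc : bil_code ((m * a - n) * gcdn b c) (n * a) (n * a)
      (b %/ gcdn b c) (c %/ gcdn b c) =
    bil_code ((m * a - n) * gcdn b c) (n * a) (n * a)
      (b2 %/ gcdn b c) (c2 %/ gcdn b c).
    by rewrite -GG in cc1 cc2; rewrite /bil_code cc1 cc2.
  have [xx yy ->] := bil_code_inj M0 A A2 cc P0.
  rewrite -GE in bE cE; rewrite -GE2 -GG in bE2 cE2.
  have bb : b = b2 by rewrite [LHS]bE [RHS]bE2 xx.
  have {}cc : c = c2 by rewrite [LHS]cE [RHS]cE2 yy.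
  by rewrite bb cc.
- move=> [[[a b] c] d] /hS sol.
  have A := sol4_bilA n0 sol; have [_ u0 N0 _] := sol4_pos n0 sol.
  have [h0 g0 x0 y0 _] := sol4_gcd_gt0 sol.
  have [a0 _ _ _] := sol4_gt0 sol.
  have [[z4 _ az] _] := sol4_size n0 nz sol.
  have [_ _ gz _ _] := sol4_gcd_size n0 nz sol.
  have z0 : (0 < z)%N by exact: leq_trans z4.
  rewrite /phi /psi /F/=; split.
  + apply: allpairs_f_dep.
      by rewrite mem_firsts; have [-> ->] := sol4_step1 n0 sol.
    apply: allpairs_f_dep; first by rewrite -dvdn_divisors// dvdn_gcdl.
    rewrite mem_index_iota g0 ltnS/=; apply: leq_trans gz _.
    by rewrite leq_pexp2l.
  + have [bE cE aE GE] := sol4_gcd a b c.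
    by rewrite {1}GE; apply: (mem_bil_codes _ _ _ A); rewrite ?muln_gt0 ?n0 ?a0 ?h0 ?g0.
  + apply: (size_bil_codes Q1 tQ); rewrite ?muln_gt0 ?n0 ?a0 ?h0 ?g0 ?u0//.
    exact: (sol4_sizeA n0 nz sol).
Qed.

(** The key is [(x, y, h)], with at most [Q ^ 2] codes from [sol4_bilB]; the weights sum to the cube
    of a harmonic sum. *)
Lemma sum_inv_xyh_le : \sum_(s <- S) (let: (a, b, c, d) := s in let G := gcdn b c in
    (b %/ G * (c %/ G) * gcdn a G)%:R^-1) <= Q ^+ 5 :> R.
Proof.
pose phi (s : nat * nat * nat * nat) := let: (a, b, c, d) := s in
  let G := gcdn b c in (b %/ G, (c %/ G, gcdn a G))%N.
pose psi (s : nat * nat * nat * nat) := let: (a, b, c, d) := s in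
  let G := gcdn b c in let h := gcdn a G in let x := (b %/ G)%N in
  let y := (c %/ G)%N in
  bil_code (m * h * x * y) (n * (x + y)) (n * x * y) (a %/ h) (G %/ h).
pose w (k : nat * (nat * nat)) : R := (k.1 * k.2.1 * k.2.2)%:R^-1.
pose F (k : nat * (nat * nat)) := let: (x, (y, h)) := k in
  bil_codes (m * h * x * y) (n * (x + y)) (n * x * y) (n * h * x * y).
pose I := index_iota 1 (z ^ 30).+1.
pose L := [seq (x, yh) | x <- I, yh <- [seq (y, h) | y <- I, h <- I]].
apply: (@le_trans _ _ (\sum_(s <- S) w (phi s))).
  by apply: ler_sum => -[[[a b] c] d].
apply: (@le_trans _ _ (Q ^+ 2 * \sum_(k <- L) w k)); last first.
  rewrite (exprD Q 2 3) ler_wpM2l ?exprn_ge0//.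
  have -> : \sum_(k <- L) w k = (\sum_(i <- I) i%:R^-1) ^+ 3.
    rewrite /L big_allpairs_dep/= !exprS expr0 mulr1 mulr_suml.
    apply: eq_bigr => x _; rewrite big_allpairs_dep/= mulr_suml mulr_sumr.
    apply: eq_bigr => y _; rewrite mulr_sumr mulr_sumr.
    by apply: eq_bigr => h _; rewrite /w !natrM !invfM mulrA.
  by rewrite lerXn2r// nnegrE sumr_ge0// => i _; rewrite invr_ge0.
apply: (@sum_fiber _ _ _ _ S phi psi L F w).
- by [].
- exact: exprn_ge0.
- by move=> k; rewrite invr_ge0.
- move=> [[[a b] c] d] [[[a2 b2] c2] d2] sS sS2; move: (hS sS) (hS sS2) => sol sol2.
  rewrite /phi /psi/= => -[xx yy hh cc1 cc2].
  have [bE cE aE _] := sol4_gcd a b c; have [bE2 cE2 aE2 _] := sol4_gcd a2 b2 c2.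
  have B := sol4_bilB sol; have B2 := sol4_bilB sol2.
  have [m0 _ _ _] := sol4_pos n0 sol.
  have [h0 g0 x0 y0 _] := sol4_gcd_gt0 sol.
  rewrite -xx -yy -hh in B2 bE2 cE2 aE2 cc1 cc2.
  move: (b %/ gcdn b c)%N (c %/ gcdn b c)%N (gcdn a (gcdn b c)) => x y h in
    B B2 bE cE aE bE2 cE2 aE2 h0 g0 x0 y0 cc1 cc2 *.
  have M0 : (0 < n * h * x * y)%N by rewrite !muln_gt0 n0 h0 x0.
  have P0 : (0 < m * h * x * y)%N by rewrite !muln_gt0 m0 h0 x0.
  have [aa gg ->] := bil_code_inj M0 B B2 (f_equal2 pair cc1 cc2) P0.
  have -> : a = a2 by rewrite [LHS]aE [RHS]aE2 aa.
  have bb : b = b2 by rewrite [LHS]bE [RHS]bE2 gg.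
  have cc : c = c2 by rewrite [LHS]cE [RHS]cE2 gg.
  by rewrite bb cc.
- move=> [[[a b] c] d] /hS sol.
  have B := sol4_bilB sol; have [m0 u0 N0 _] := sol4_pos n0 sol.
  have [h0 g0 x0 y0 _] := sol4_gcd_gt0 sol.
  have [[z4 _ az] _] := sol4_size n0 nz sol.
  have [hz _ _ xz yz] := sol4_gcd_size n0 nz sol.
  have z0 : (0 < z)%N by exact: leq_trans z4.
  rewrite /phi /psi /F/=; split.
  + apply: allpairs_f_dep; last apply: allpairs_f_dep.
    * rewrite mem_index_iota x0 ltnS/=; apply: leq_trans xz _.
      by rewrite leq_pexp2l.
    * rewrite mem_index_iota y0 ltnS/=; apply: leq_trans yz _.
      by rewrite leq_pexp2l.
    * rewrite mem_index_iota h0 ltnS/=; apply: leq_trans hz _.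
      by rewrite -[leqLHS]expn1 leq_pexp2l.
  + by apply: (mem_bil_codes _ _ _ B); rewrite ?muln_gt0 ?addn_gt0 ?n0 ?h0 ?x0 ?y0.
  + apply: (size_bil_codes Q1 tQ);
      rewrite ?muln_gt0 ?addn_gt0 ?n0 ?m0 ?h0 ?x0 ?y0//.
    exact: (sol4_sizeB n0 nz sol).
Qed.

(** The key is [(a, b)], with at most [Q] codes from [sol4_codeC]; [sum_sigma_le] bounds the sum
    over the keys by [Q ^ 2]. *)
Lemma sum_inv_v_le : \sum_(s <- S) (let: (a, b, c, d) := s in
    ((m * a - n) * b - n * a)%:R^-1) <= Q ^+ 3 :> R.
Proof.
pose phi (s : nat * nat * nat * nat) := let: (a, b, c, d) := s in (a, b).
pose psi (s : nat * nat * nat * nat) := let: (a, b, c, d) := s in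
  (((m * a - n) * b - n * a) * c - n * a * b)%N.
pose F (k : nat * nat) := divisors ((n * k.1 * k.2) ^ 2).
pose w (k : nat * nat) : R := ((m * k.1 - n) * k.2 - n * k.1)%:R^-1.
pose L := [seq (a, b) | a <- firsts 5 m n, b <- firsts 4 (m * a - n) (n * a)].
apply: (@le_trans _ _ (\sum_(s <- S) w (phi s))).
  by apply: ler_sum => -[[[a b] c] d].
apply: (@le_trans _ _ (Q * \sum_(k <- L) w k)); last first.
  rewrite exprS ler_wpM2l// /L big_allpairs_dep/=; exact: (sum_sigma_le m n0 nz).
apply: (@sum_fiber _ _ _ _ S phi psi L F w).
- by [].
- by [].
- by move=> k; rewrite invr_ge0.
- move=> [[[a b] c] d] [[[a2 b2] c2] d2] sS sS2; move: (hS sS) (hS sS2) => sol sol2.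
  rewrite /phi /psi/= => -[aa bb]; subst a2 b2.
  have [lt _ eq] := sol4_step3 n0 sol; have [lt2 _ eq2] := sol4_step3 n0 sol2.
  have [_ _ _ v0] := sol4_pos n0 sol.
  move=> ww; rewrite -ww in eq2.
  have cc : c = c2.
    apply/eqP; rewrite -(eqn_pmul2l v0); apply/eqP.
    by rewrite -(subnK (ltnW lt)) -(subnK (ltnW lt2)) ww.
  subst c2; congr pair.
  have w0 : (0 < ((m * a - n) * b - n * a) * c - n * a * b)%N by rewrite subn_gt0.
  by apply/eqP; rewrite -(eqn_pmul2l w0) eq eq2.
- move=> [[[a b] c] d] /hS sol.
  have [h1 h2 _] := sol4_step1 n0 sol; have [h3 h4 _] := sol4_step2 n0 sol.
  have [[z4 _ az] [_ Nz bz _ _]] := sol4_size n0 nz sol.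
  have [_ _ N0 _] := sol4_pos n0 sol; have [_ b0 _ _] := sol4_gt0 sol.
  have z0 : (0 < z)%N by exact: leq_trans z4.
  rewrite /phi /psi /F/=; split.
  (* The ranges [m a <= 4 n] and [u b <= 3 N] are widened to those of [sum_sigma_le]. *)
  + apply: allpairs_f_dep; rewrite mem_firsts ?h1 ?h3/=.
      by rewrite (leq_trans h2)// leq_mul2r orbT.
    by rewrite (leq_trans h4)// leq_mul2r orbT.
  + exact: (sol4_codeC n0 sol).
  + apply: tQ; rewrite expn_gt0 muln_gt0 N0 b0/= -mulnn.
    by apply: (@le_powM _ 4 4) => //; apply: (@le_powM _ 2 2).
Qed.

Lemma four_terms_bound :
  (size S)%:R ^+ 2 <= 34 * (n%:R ^+ 3 / m%:R) * Q ^+ 8 * sigma m n.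
Proof.
have [->|SN] := eqVneq S [::].
  by rewrite expr0n/= !mulr_ge0 ?exprn_ge0 ?sigma_ge0// invr_ge0.
have [s0 s0S] : exists s, s \in S.
  by case: S SN => // s r _; exists s; rewrite mem_head.
have m0 : (0 < m)%N.
  by move: s0 s0S => [[[a b] c] d] /hS sol; have [] := sol4_pos n0 sol.
have m1 : 1 <= m%:R :> R by rewrite ler1n.
have m0' : 0 < m%:R :> R by rewrite ltr0n.
pose r (s : nat * nat * nat * nat) : R := let: (a, b, c, d) := s in
  let G := gcdn b c in ((G %/ gcdn a G) * (m * a - n))%:R.
pose q (s : nat * nat * nat * nat) : R := let: (a, b, c, d) := s in
  let G := gcdn b c in (b %/ G * (c %/ G) * gcdn a G)%:R^-1.
pose t (s : nat * nat * nat * nat) : R := let: (a, b, c, d) := s in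
  ((m * a - n) * b - n * a)%:R^-1.
pose X : R := n%:R ^+ 2 / m%:R.
have X0 : 0 <= X by rewrite divr_ge0.
(* [K] dominates the [18 N ^ 3] of [sol4_weight], since [m a <= 4 n] gives [N = n a <= 4 X]. *)
have [K K0 KE] : exists2 K : R, 0 <= K & K = 18 * (4 * X) ^+ 3.
  by eexists; last reflexivity; rewrite mulr_ge0// exprn_ge0// mulr_ge0.
(* First use of Cauchy-Schwarz, with [r = g u]; the second one bounds the sum of [r] through
   [r ^ 2 <= q K t]. *)
have cs1 : (\sum_(s <- S) 1) ^+ 2 <= (\sum_(s <- S) (r s)^-1) * \sum_(s <- S) r s.
  apply: cauchy_schwarz_seq => -[[[a b] c] d] /hS sol.
  have [_ u0 _ _] := sol4_pos n0 sol; have [h0 g0 _ _ _] := sol4_gcd_gt0 sol.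
  by rewrite invr_ge0 /r ler0n expr1n mulVf// pnatr_eq0 -lt0n muln_gt0 g0 u0.
have cs2 : (\sum_(s <- S) r s) ^+ 2 <=
    (\sum_(s <- S) q s) * \sum_(s <- S) (K * t s).
  apply: cauchy_schwarz_seq => -[[[a b] c] d] /hS sol.
  have wt := sol4_weight n0 sol.
  have [_ ma _] := sol4_step1 n0 sol.
  have [_ _ _ v0] := sol4_pos n0 sol; have [h0 g0 x0 y0 _] := sol4_gcd_gt0 sol.
  rewrite /r /q /t; split.
  - exact: ler0n.
  - by rewrite invr_ge0.
  - by rewrite mulr_ge0// invr_ge0.
  move: wt v0 g0 h0 x0 y0.
  move: ((m * a - n) * b - n * a)%N (gcdn b c %/ gcdn a (gcdn b c))%N
    (m * a - n)%N (b %/ gcdn b c)%N (c %/ gcdn b c)%N (gcdn a (gcdn b c)) =>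
    v g u x y h wt v0 g0 h0 x0 y0.
  have p0 : (0 < x * y * h)%N by rewrite !muln_gt0 x0 y0 h0.
  have NX : (n * a)%:R <= 4 * X.
    rewrite /X mulrA ler_pdivlMr// -natrX -!natrM ler_nat.
    have -> : (n * a * m = n * (m * a))%N by ring.
    have -> : (4 * n ^ 2 = n * (4 * n))%N by ring.
    by rewrite leq_mul2l ma orbT.
  rewrite ler_pdivlMl ?ltr0n//.
  rewrite ler_pdivlMr ?ltr0n//.
  apply: (@le_trans _ _ (18 * (n * a)%:R ^+ 3)).
    rewrite -!natrX -!natrM ler_nat; apply: leq_trans wt.
    by rewrite leq_eqVlt; apply/orP; left; apply/eqP; ring.
  by rewrite KE ler_pM2l ?ltr0n// lerXn2r// nnegrE// mulr_ge0.
have sA : \sum_(s <- S) (r s)^-1 <= Q ^+ 4 * sigma m n.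
  apply: le_trans (sum_inv_gu_le).
  by apply: ler_sum => -[[[a b] c] d].
have sB : \sum_(s <- S) q s <= Q ^+ 5.
  apply: le_trans (sum_inv_xyh_le).
  by apply: ler_sum => -[[[a b] c] d].
have sC : \sum_(s <- S) t s <= Q ^+ 3.
  by apply: le_trans sum_inv_v_le; apply: ler_sum => -[[[a b] c] d].
rewrite big_const_seq count_predT iter_addr_0 in cs1.
have r0 : 0 <= \sum_(s <- S) r s.
  by apply: sumr_ge0 => -[[[a b] c] d] _; rewrite ler0n.
have q0 : 0 <= \sum_(s <- S) q s.
  by apply: sumr_ge0 => -[[[a b] c] d] _; rewrite invr_ge0.
have t0 : 0 <= \sum_(s <- S) t s.
  by apply: sumr_ge0 => -[[[a b] c] d] _; rewrite invr_ge0.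
have sg0 := sigma_ge0 m n.
rewrite -mulr_sumr in cs2.
have {}cs2 : (\sum_(s <- S) r s) ^+ 2 <= Q ^+ 5 * (K * Q ^+ 3).
  apply: le_trans cs2 _; apply: ler_pM => //; first exact: mulr_ge0.
  by rewrite ler_wpM2l.
rewrite -ler_sqr ?nnegrE ?sqr_ge0 ?mulr_ge0 ?exprn_ge0 ?invr_ge0//.
apply: (@le_trans _ _ ((Q ^+ 4 * sigma m n * \sum_(s <- S) r s) ^+ 2)).
  rewrite lerXn2r ?nnegrE ?sqr_ge0 ?mulr_ge0 ?exprn_ge0//.
  by rewrite (le_trans cs1)// ler_wpM2r.
rewrite exprMn; apply: (@le_trans _ _ ((Q ^+ 4 * sigma m n) ^+ 2 *
  (Q ^+ 5 * (K * Q ^+ 3)))); first by rewrite ler_wpM2l ?sqr_ge0.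
(* One factor [m >= 1] is given up so that the right side is a perfect square: the inequality to be
   proved has been squared once more. *)
have XX : X ^+ 3 <= (n%:R ^+ 3 / m%:R) ^+ 2.
  have mN : m%:R != 0 :> R by exact: lt0r_neq0.
  have -> : X ^+ 3 = (n%:R ^+ 3) ^+ 2 * (m%:R ^+ 3)^-1 by rewrite /X; field.
  have -> : (n%:R ^+ 3 / m%:R) ^+ 2 = (n%:R ^+ 3) ^+ 2 * (m%:R ^+ 2)^-1 :> R by field.
  rewrite ler_wpM2l ?exprn_ge0//.
  by rewrite lef_pV2 ?posrE ?exprn_gt0// ler_weXn2l.
have Y0 : 0 <= (n%:R ^+ 3 / m%:R) ^+ 2 :> R by exact: sqr_ge0.
have -> : (Q ^+ 4 * sigma m n) ^+ 2 * (Q ^+ 5 * (K * Q ^+ 3)) =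
  K * (Q ^+ 16 * sigma m n ^+ 2) by ring.
have -> : (34 * (n%:R ^+ 3 / m%:R) * Q ^+ 8 * sigma m n) ^+ 2 =
  (1156 * (n%:R ^+ 3 / m%:R) ^+ 2) * (Q ^+ 16 * sigma m n ^+ 2) by ring.
rewrite ler_wpM2r ?mulr_ge0 ?exprn_ge0//.
(* The constant 34 comes from [18 * 4 ^ 3 = 1152 <= 34 ^ 2 = 1156]. *)
rewrite KE exprMn mulrA; apply: ler_pM => //; first exact: exprn_ge0.
by rewrite -natrX -natrM ler_nat.
Qed.

End FourTerms.

(** * Sums of five unit fractions *)

Lemma mem_egyptian k m n (t : k.-tuple nat) :
  (t \in fset_set (egyptian_tuples k m n)) <-> egyptian_tuples k m n t.
Proof.
rewrite in_fset_set; last exact: finite_egyptian_tuples.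
by rewrite inE.
Qed.

Lemma egyptian_behead k m n (t : k.+1.-tuple nat) : (0 < k)%N -> (0 < n)%N ->
  egyptian_tuples k.+1 m n t ->
  let a := thead t in
  (n < m * a <= k.+1 * n)%N /\
  egyptian_tuples k (m * a - n) (n * a) (behead_tuple t : k.-tuple nat).
Proof.
move=> k0 n0 [t0 tle tE] a.
have tb (i : 'I_k) : tnth (behead_tuple t : k.-tuple nat) i = tnth t (lift ord0 i).
  by rewrite !(tnth_nth 0%N) nth_behead.
have a0 : (0 < a)%N by exact: t0.
have n0' : n%:R != 0 :> rat by rewrite pnatr_eq0 -lt0n.
have a0' : a%:R != 0 :> rat by rewrite pnatr_eq0 -lt0n.
rewrite big_ord_recl -[tnth t ord0]/a in tE.
(* The tail has [k > 0] terms, so [1 / a < m / n] strictly and [m a - n] is positive. *)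
have tail0 : 0 < \sum_(i < k) (tnth t (lift ord0 i))%:R^-1 :> rat.
  case: k k0 t t0 tle a tE tb a0 a0' => // k _ t t0 tle a tE tb a0 a0'.
  rewrite big_ord_recl ltr_pwDl ?invr_gt0 ?ltr0n//.
  by apply: sumr_ge0 => i _; rewrite invr_ge0.
have nma : (n < m * a)%N.
  have : a%:R^-1 < m%:R / n%:R :> rat by rewrite tE ltrDl.
  by rewrite ltr_pdivlMr ?ltr0n// mulrC ltr_pdivrMr ?ltr0n// -natrM ltr_nat.
split.
  rewrite nma/=.
  have : m%:R / n%:R <= k.+1%:R / a%:R :> rat.
    rewrite tE -natr1 mulrDl mul1r addrC lerD2r.
    apply: (@le_trans _ _ (\sum_(i < k) a%:R^-1)).
      apply: ler_sum => i _; rewrite lef_pV2 ?posrE ?ltr0n ?ler_nat//.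
      exact: tle.
    by rewrite sumr_const card_ord -[leLHS]mulr_natl.
  rewrite ler_pdivrMr ?ltr0n// mulrAC ler_pdivlMr ?ltr0n//.
  by rewrite -!natrM ler_nat.
split.
- by move=> i; rewrite tb.
- by move=> i j ij; rewrite !tb; apply: tle; rewrite !lift0 ltnS.
- under eq_bigr do rewrite tb.
  rewrite natrB ?(ltnW nma)// !natrM mulrBl.
  have -> : \sum_(i < k) (tnth t (lift ord0 i))%:R^-1 = m%:R / n%:R - a%:R^-1 :> rat.
    by rewrite tE addrC addKr.
  by field; rewrite n0' a0'.
Qed.

Lemma egyptian_count_rec k m n : (0 < k)%N -> (0 < n)%N ->
  (egyptian_count k.+1 m n <=
   \sum_(a <- firsts k.+1 m n) egyptian_count k (m * a - n) (n * a))%N.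
Proof.
move=> k0 n0.
pose L := [seq (a, t) | a <- firsts k.+1 m n,
  t <- enum_fset (fset_set (egyptian_tuples k (m * a - n) (n * a)))].
have -> : (\sum_(a <- firsts k.+1 m n) egyptian_count k (m * a - n) (n * a))%N =
    size L by rewrite /L size_allpairs_dep sumnE big_map.
pose f (t : k.+1.-tuple nat) := (thead t, behead_tuple t : k.-tuple nat).
have fI : injective f.
  move=> t t' [h b]; rewrite (tuple_eta t) (tuple_eta t'); apply: val_inj => /=.
  by rewrite h b.
rewrite /egyptian_count -(size_map f); apply: uniq_leq_size.
  by rewrite map_inj_uniq// fset_uniq.
move=> p /mapP[t /mem_egyptian tS ->].
have [th tb] := egyptian_behead k0 n0 tS.
by apply: allpairs_f_dep; [rewrite mem_firsts|exact/mem_egyptian].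
Qed.

Lemma egyptian_count4 m n : (0 < n)%N ->
  exists S : seq (nat * nat * nat * nat), [/\ uniq S,
    (forall a b c d, (a, b, c, d) \in S -> sol4 m n a b c d) &
    egyptian_count 4 m n = size S].
Proof.
move=> n0.
pose f (t : 4.-tuple nat) := (nth 0 t 0, nth 0 t 1, nth 0 t 2, nth 0 t 3)%N.
exists [seq f t | t <- enum_fset (fset_set (egyptian_tuples 4 m n))]; split.
- rewrite map_inj_uniq ?fset_uniq// => t t' [h0 h1 h2 h3].
  apply: eq_from_tnth => -[[|[|[|[|//]]]] hi]; by rewrite !(tnth_nth 0%N).
- move=> a b c d /mapP[t /mem_egyptian [t0 tle tE] [-> -> -> ->]].
  have T i (hi : (i < 4)%N) : nth 0%N t i = tnth t (Ordinal hi) by rewrite (tnth_nth 0%N).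
  have pos i (hi : (i < 4)%N) : (0 < nth 0%N t i)%N by rewrite (T _ hi).
  have le i j (hi : (i < 4)%N) (hj : (j < 4)%N) : (i <= j)%N ->
      (nth 0 t i <= nth 0 t j)%N by move=> ij; rewrite (T _ hi) (T _ hj) tle.
  split; rewrite ?le ?pos//.
  have : m%:R / n%:R = (nth 0%N t 0)%:R^-1 + (nth 0%N t 1)%:R^-1 +
      (nth 0%N t 2)%:R^-1 + (nth 0%N t 3)%:R^-1 :> rat.
    rewrite tE; under eq_bigr do rewrite (tnth_nth 0%N).
    by rewrite !big_ord_recl big_ord0 addr0 !addrA.
  have := pos 0%N isT; have := pos 1%N isT; have := pos 2%N isT; have := pos 3%N isT.
  move: (nth 0%N t 0) (nth 0%N t 1) (nth 0%N t 2) (nth 0%N t 3) => x y z w w0 z0 y0 x0.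
  have nz i : (0 < i)%N -> i%:R != 0 :> rat by rewrite pnatr_eq0 -lt0n.
  move=> /(congr1 (fun q => q * (n * x * y * z * w)%:R)) e.
  apply/eqP; rewrite -(eqr_nat rat); apply/eqP.
  have -> : (m * x * y * z * w)%:R = m%:R / n%:R * (n * x * y * z * w)%:R :> rat.
    by rewrite !natrM; field; rewrite nz.
  rewrite e !natrM !natrD !natrM; field.
  by rewrite !nz.
- by rewrite size_map.
Qed.

(** The map sending [a] to [m a - n] is injective with values from 1 to [B], so this is [sum_fiber]
    with a single code. *)
Lemma sum_firsts (R : realFieldType) k m n B (w : nat -> R) : (0 < m)%N ->
  (k * n <= B)%N -> (forall i, 0 <= w i) ->
  \sum_(a <- firsts k m n) w (m * a - n)%N <= \sum_(1 <= i < B.+1) w i.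
Proof.
move=> m0 kB w0; rewrite -[leRHS]mul1r.
apply: (@sum_fiber _ _ _ _ _ (fun a => m * a - n)%N (fun=> tt) _ (fun=> [:: tt])) => //.
- exact: firsts_uniq.
- move=> a b; rewrite !mem_firsts => /andP[a1 _] /andP[b1 _] [ab].
  apply/eqP; rewrite -(eqn_pmul2l m0); apply/eqP.
  by rewrite -(subnK (ltnW a1)) -(subnK (ltnW b1)) ab.
- move=> a; rewrite mem_firsts => /andP[a1 a2]; split=> //.
  rewrite mem_index_iota subn_gt0 a1 ltnS/= (leq_trans (leq_subr _ _))//.
  exact: leq_trans a2 kB.
Qed.

Section FiveTerms.
Variables (R : realFieldType) (Q : R) (z : nat).
Hypothesis Q1 : 1 <= Q.
Hypothesis tQ : forall x, (0 < x <= z ^ 30)%N -> (tau x)%:R <= Q.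
Hypothesis hQ : \sum_(1 <= i < (z ^ 30).+1) i%:R^-1 <= Q.

(** By [four_terms_bound], [f_4 (u, n a) ^ 2] is at most [1 / u] times a multiple of [sigma], with
    [n a <= 5 X]. Cauchy-Schwarz over [a] leaves the sum of [1 / u], at most [Q], and the sum of
    [sigma], at most [Q ^ 2]; whence [Q ^ (8 + 1 + 2)] and [5 ^ 3 = 125]. *)
Lemma five_terms_bound m n : (0 < m)%N -> (0 < n)%N -> (20 * n ^ 2 <= z)%N ->
  (egyptian_count 5 m n)%:R ^+ 2 <= 34 * 125 * Q ^+ 11 * (n%:R ^+ 2 / m%:R) ^+ 3.
Proof.
move=> m0 n0 nz.
have Q0 : 0 <= Q by exact: le_trans Q1.
have z1 : (1 <= z)%N by apply: leq_trans nz; rewrite muln_gt0 expn_gt0 n0.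
have nn : (n <= n ^ 2)%N by rewrite -mulnn leq_pmull.
pose u a := (m * a - n)%N.
pose X : R := n%:R ^+ 2 / m%:R.
have X0 : 0 <= X by rewrite divr_ge0.
have m0' : 0 < m%:R :> R by rewrite ltr0n.
have sumV : \sum_(a <- firsts 5 m n) (u a)%:R^-1 <= Q.
  apply: le_trans hQ.
  apply: (@sum_firsts _ 5 m n (z ^ 30) (fun k => k%:R^-1)) => //.
  apply: (@leq_trans (z ^ 1)%N); last by rewrite leq_pexp2l.
  by rewrite expn1 (leq_trans _ nz)// leq_mul.
have Nb a : (n < m * a <= 5 * n)%N -> (4 * (n * a) <= z)%N /\ (n * a)%:R <= 5 * X.
  move=> /andP[_ a2]; split.
    rewrite (leq_trans _ nz)// -mulnn.
    have -> : (20 * (n * n) = 4 * (n * (5 * n)))%N by ring.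
    by rewrite !leq_mul2l (leq_trans _ a2) ?orbT// leq_pmull.
  rewrite /X mulrA ler_pdivlMr// -natrX -!natrM ler_nat.
  have -> : (n * a * m = n * (m * a))%N by ring.
  have -> : (5 * n ^ 2 = n * (5 * n))%N by ring.
  by rewrite leq_mul2l a2 orbT.
have cs : (\sum_(a <- firsts 5 m n) (egyptian_count 4 (u a) (n * a))%:R) ^+ 2 <=
    (\sum_(a <- firsts 5 m n) (u a)%:R^-1) *
    \sum_(a <- firsts 5 m n) (34 * Q ^+ 8 * (5 * X) ^+ 3 * sigma R (u a) (n * a)).
  apply: cauchy_schwarz_seq => a; rewrite mem_firsts => aP.
  have [Nz NX] := Nb _ aP; move/andP: aP => [a1 a2].
  have u0 : (0 < u a)%N by rewrite subn_gt0.
  have /andP[_ a0] : (0 < m)%N && (0 < a)%N by rewrite -muln_gt0 (leq_ltn_trans _ a1).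
  have N0 : (0 < n * a)%N by rewrite muln_gt0 n0.
  have [S [uS hS ->]] := egyptian_count4 (u a) N0.
  have fb := four_terms_bound Q1 tQ hQ N0 Nz uS hS.
  have sg0 := sigma_ge0 R (u a) (n * a).
  split.
  - exact: ler0n.
  - by rewrite invr_ge0.
  - by rewrite !mulr_ge0// ?exprn_ge0// mulr_ge0.
  - apply: le_trans fb _.
    have -> : 34 * ((n * a)%:R ^+ 3 / (u a)%:R) * Q ^+ 8 * sigma R (u a) (n * a) =
      (u a)%:R^-1 * (34 * Q ^+ 8 * (n * a)%:R ^+ 3 * sigma R (u a) (n * a)) by ring.
    rewrite ler_wpM2l ?invr_ge0// ler_wpM2r// ler_wpM2l ?mulr_ge0 ?exprn_ge0//.
    by rewrite lerXn2r// nnegrE// mulr_ge0.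
apply: (@le_trans _ _
    ((\sum_(a <- firsts 5 m n) (egyptian_count 4 (u a) (n * a))%:R) ^+ 2)).
  rewrite -natr_sum lerXn2r ?nnegrE ?ler0n// ler_nat.
  exact: egyptian_count_rec.
apply: le_trans cs _; rewrite -mulr_sumr.
have rho := sum_sigma_le Q1 tQ hQ m n0 (leq_trans (leq_mul (_ : 4 <= 20)%N nn) nz).
have s0 : 0 <= \sum_(a <- firsts 5 m n) sigma R (u a) (n * a).
  by apply: sumr_ge0 => a _; exact: sigma_ge0.
have v0 : 0 <= \sum_(a <- firsts 5 m n) (u a)%:R^-1 :> R.
  by apply: sumr_ge0 => a _; rewrite invr_ge0.
apply: (@le_trans _ _ (Q * (34 * Q ^+ 8 * (5 * X) ^+ 3 * Q ^+ 2))).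
  apply: ler_pM => //; first by rewrite !mulr_ge0// ?exprn_ge0// mulr_ge0.
  by rewrite ler_wpM2l ?mulr_ge0 ?exprn_ge0 ?mulr_ge0//; exact: rho.
rewrite le_eqVlt; apply/orP; left; apply/eqP; rewrite -/X; ring.
Qed.

End FiveTerms.

Lemma le_powR_root (R : realType) (x y : R) j : (0 < j)%N -> 0 <= x -> x ^+ j <= y ->
  x <= y `^ j%:R^-1.
Proof.
move=> j0 x0 xy.
have -> : x = (x ^+ j) `^ j%:R^-1.
  by rewrite -powR_mulrn// -powRrM mulfV ?powRr1// pnatr_eq0 -lt0n.
apply: ge0_ler_powR => //; rewrite ?nnegrE ?exprn_ge0//.
by apply: le_trans xy; exact: exprn_ge0.
Qed.

Lemma five_terms (R : realType) : exists2 C : R, 0 < C & forall m n,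
  (0 < m)%N -> (0 < n)%N ->
  (egyptian_count 5 m n)%:R <= C * (n%:R ^+ 2 / m%:R) `^ (8 / 5).
Proof.
(* Below, [Q] is the [j]-th root of a constant times [z ^ 30], where [z = 20 n ^ 2]. This [j] makes
   [Q ^ 11] a constant times [n ^ (1 / 5)]. *)
have [j [j0 jE]] : exists j, (0 < j)%N /\ (11 * 60)%:R / j%:R = 1 / 5 :> R.
  exists (11 * 60 * 5)%N; split=> //.
  by rewrite [X in _ / X]natrM invfM mulrA mulfV// pnatr_eq0.
have [C1 C10 hC1] := tau_bound j.
have [C2 C20 hC2] := harmonic_bound R j.
have [c cE] : exists c, c = 20%N by exists 20%N.
have c0 : (0 < c)%N by rewrite cE.
have [c' c'0 c'E] : exists2 c' : R, 0 <= c' & c' = 34 * 125 by exists (34 * 125).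
pose K := (C1 * C2 * c ^ 30)%N.
have K0 : (0 < K)%N by rewrite 2!muln_gt0 C10 C20 expn_gt0 c0.
pose C3 : R := c' * (K%:R `^ (11 / j%:R) * 5 `^ (1 / 5)).
have C30 : 0 <= C3 by rewrite mulr_ge0// mulr_ge0// powR_ge0.
(* The squared bound comes with the constant [C3], and [C3 <= (1 + C3) ^ 2]. *)
exists (1 + C3) => [|m n m0 n0]; first by rewrite ltr_pwDl.
have C1C : 1 <= 1 + C3 by rewrite lerDl.
have CC0 : 0 <= 1 + C3 by exact: le_trans C1C.
have m0' : 0 < m%:R :> R by rewrite ltr0n.
have n0' : 0 < n%:R :> R by rewrite ltr0n.
have X0 : 0 < n%:R ^+ 2 / m%:R :> R by rewrite divr_gt0// exprn_gt0.
(* For [m > 5 n] there is no solution, five unit fractions adding up to at most 5. Otherwise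
   [n <= 5 X], which turns the loss [n ^ (1 / 5)] into a power of [X]. *)
have [m5|m5] := leqP m (5 * n); last first.
  have : (egyptian_count 5 m n <= 0)%N.
    apply: leq_trans (egyptian_count_rec _ _ _) _ => //.
    case e : (firsts 5 m n) => [|a s]; first by rewrite big_nil.
    have : a \in firsts 5 m n by rewrite e mem_head.
    rewrite mem_firsts => /andP[a1 a2].
    have /andP[_ a0] : (0 < m)%N && (0 < a)%N by rewrite -muln_gt0 (leq_ltn_trans _ a1).
    by move: m5; rewrite ltnNge (leq_trans _ a2)// leq_pmulr.
  by rewrite leqn0 => /eqP ->; rewrite mulr_ge0// powR_ge0.
pose z := (c * n ^ 2)%N.
pose M := (C1 * C2 * z ^ 30)%N.
have z30 : (0 < z ^ 30)%N by rewrite expn_gt0 muln_gt0 c0 expn_gt0 n0.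
have ME : M = (K * n ^ 60)%N by rewrite /M /K /z expnMn -expnM mulnA.
have C1M : (C1 * z ^ 30 <= M)%N by rewrite leq_mul2r leq_pmulr ?orbT.
have C2M : (C2 * z ^ 30 <= M)%N by rewrite leq_mul2r leq_pmull ?orbT.
pose Q : R := M%:R `^ j%:R^-1.
have Q1 : 1 <= Q.
  apply: le_powR_root => //; rewrite expr1n ler1n (leq_trans _ C1M)//.
  by rewrite muln_gt0 C10.
have tQ x : (0 < x <= z ^ 30)%N -> (tau x)%:R <= Q.
  move=> /andP[x0 xz]; apply: le_powR_root => //.
  rewrite -natrX ler_nat (leq_trans (hC1 _ x0))//.
  by apply: leq_trans C1M; rewrite leq_mul2l xz orbT.
have hQ : \sum_(1 <= i < (z ^ 30).+1) i%:R^-1 <= Q.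
  apply: le_powR_root => //; first by apply: sumr_ge0 => i _; rewrite invr_ge0.
  by apply: le_trans (hC2 _ z30) _; rewrite ler_nat.
have zle : (20 * n ^ 2 <= z)%N by rewrite /z cE.
have := five_terms_bound Q1 tQ hQ m0 n0 zle.
rewrite -c'E.
move: X0; set X := n%:R ^+ 2 / m%:R => X0 f5.
have nX : n%:R <= 5 * X.
  rewrite /X mulrA ler_pdivlMr// expr2 mulrCA ler_wpM2l//.
  by rewrite -natrM ler_nat.
have QE : Q ^+ 11 <= K%:R `^ (11 / j%:R) * 5 `^ (1 / 5) * X `^ (1 / 5).
  rewrite -powR_mulrn ?powR_ge0// -powRrM mulrC ME natrM powRM//.
  rewrite -mulrA ler_wpM2l ?powR_ge0//.
  rewrite natrX -powR_mulrn// -powRrM mulrA -natrM mulnC jE -powRM//; last exact: ltW.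
  by apply: ge0_ler_powR => //; rewrite ?nnegrE ?mulr_ge0// ltW.
(* Twice [8 / 5] is [3 + 1 / 5]: the exponent in [five_terms_bound] plus the loss from [Q ^ 11]. *)
have XE : (X `^ (8 / 5)) ^+ 2 = X `^ (1 / 5) * X ^+ 3.
  rewrite -powR_mulrn ?powR_ge0// -powRrM -[X ^+ 3]powR_mulrn ?ltW//.
  rewrite -powRD; last by rewrite gt_eqF// implybT.
  by congr powR; field.
rewrite -ler_sqr ?nnegrE// ?mulr_ge0 ?powR_ge0//.
apply: le_trans f5 _; rewrite [leRHS]exprMn XE.
apply: (@le_trans _ _ (C3 * (X `^ (1 / 5) * X ^+ 3))).
  rewrite [leRHS]mulrA ler_wpM2r//; first by rewrite exprn_ge0// ltW.
  by rewrite /C3 -[leRHS]mulrA ler_wpM2l.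
apply: ler_wpM2r; first by rewrite mulr_ge0 ?powR_ge0// exprn_ge0// ltW.
by apply: (@le_trans _ _ (1 + C3)); rewrite ?lerDr// expr2 ler_peMl.
Qed.

(** * More unit fractions *)

(* Telescoping: with [s = i ^ (-1/2)] and [t = (i + 1) ^ (-1/2)] one has
   [s ^ 2 - t ^ 2 = s ^ 2 * t ^ 2], whence [t ^ 3 <= 2 * s - 2 * t]. *)
Lemma sum_powR32_le (R : realType) N :
  \sum_(1 <= i < N.+1) (i%:R^-1 : R) `^ (3 / 2) <= 3.
Proof.
have pE (i : nat) : (i%:R^-1 : R) `^ (3 / 2) = Num.sqrt i%:R^-1 ^+ 3.
  rewrite mulrC powRrM powR12_sqrt ?invr_ge0// powR_mulrn//.
case: N => [|N]; first by rewrite big_geq.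
apply: (@le_trans _ _ (3 - 2 * Num.sqrt N.+1%:R^-1 : R)); last first.
  by rewrite gerBl mulr_ge0// sqrtr_ge0.
elim: N => [|N IH].
  by rewrite big_nat1 pE invr1 sqrtr1 expr1n mulr1; lra.
rewrite big_nat_recr//= pE.
have {}IH := lerD IH (lexx (Num.sqrt (N.+2%:R^-1 : R) ^+ 3)).
apply: le_trans IH _.
have e : Num.sqrt (N.+1%:R^-1 : R) ^+ 2 - Num.sqrt (N.+2%:R^-1 : R) ^+ 2 =
    Num.sqrt (N.+1%:R^-1 : R) ^+ 2 * Num.sqrt (N.+2%:R^-1 : R) ^+ 2.
  rewrite !sqr_sqrtr ?invr_ge0// -[N.+2%:R]natr1.
  have : (0 : R) < N.+1%:R by rewrite ltr0n.
  move: (N.+1%:R : R) => x x0; field.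
  by rewrite !lt0r_neq0// addr_gt0.
have t0 : 0 < Num.sqrt (N.+2%:R^-1 : R) by rewrite sqrtr_gt0 invr_gt0 ltr0n.
have ts : Num.sqrt (N.+2%:R^-1 : R) <= Num.sqrt (N.+1%:R^-1).
  by rewrite ler_wsqrtr// lef_pV2 ?posrE ?ltr0n// ler_nat.
move: (Num.sqrt (N.+2%:R^-1 : R)) (Num.sqrt (N.+1%:R^-1 : R)) t0 ts e => t s t0 ts e.
have : t ^+ 3 <= 2 * (s - t).
  rewrite -(@ler_pM2r _ (s + t)) ?ltr_pwDr// ?(le_trans (ltW t0))//.
  have -> : 2 * (s - t) * (s + t) = 2 * (s ^+ 2 - t ^+ 2) by ring.
  rewrite e.
  have h1 : 0 <= t ^+ 2 * (s * (s - t)).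
    by rewrite !mulr_ge0 ?sqr_ge0 ?subr_ge0// (le_trans (ltW t0)).
  have h2 : 0 <= t ^+ 2 * ((s - t) * (s + t)).
    by rewrite mulr_ge0 ?sqr_ge0//; apply: mulr_ge0; lra.
  lra.
lra.
Qed.

Lemma powRX2 (R : realType) (x E : R) : 0 <= x -> (x ^+ 2) `^ E = x `^ (E * 2).
Proof. by move=> x0; rewrite mulrC powRrM powR_mulrn. Qed.

(** * Passing from [k] to [k + 1] terms *)

Section Step.
Variables (R : realType) (k : nat) (D E : R).
Hypotheses (k0 : (0 < k)%N) (D0 : 0 <= D) (E32 : 3 / 2 <= E).
Hypothesis hk : forall m n, (0 < m)%N -> (0 < n)%N ->
  (egyptian_count k m n)%:R <= D * (n%:R ^+ 2 / m%:R) `^ E.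

Let E1 : 1 <= E. Proof. by apply: le_trans E32; lra. Qed.
Let E0 : 0 <= E. Proof. by apply: le_trans E1. Qed.

(* With [u = m a - n], the ratio [(n a) ^ 2 / u] is at most [4 X ^ 2 / u] when
   [u <= n], and at most [4 (k + 1) X ^ 2 / n] otherwise. *)
Lemma egyptian_step_term m n a : (0 < m)%N -> (0 < n)%N -> a \in firsts k.+1 m n ->
  ((n * a)%:R ^+ 2 / (m * a - n)%:R) `^ E <=
  (4 * k.+1%:R) `^ E * (n%:R ^+ 2 / m%:R) `^ (E * 2) *
  ((m * a - n)%:R^-1 `^ (3 / 2) + n%:R^-1).
Proof.
move=> m0 n0; rewrite mem_firsts => /andP[a1 a2].
have u0 : (0 < m * a - n)%N by rewrite subn_gt0.
have maE : (m * a = (m * a - n) + n)%N by rewrite subnK// ltnW.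
move: (m * a - n)%N u0 maE => u u0 maE.
have m0' : 0 < m%:R :> R by rewrite ltr0n.
have n0' : 0 < n%:R :> R by rewrite ltr0n.
have u0' : 0 < u%:R :> R by rewrite ltr0n.
pose X : R := n%:R ^+ 2 / m%:R.
have X0 : 0 <= X by rewrite divr_ge0.
have c0 : 0 <= 4 * k.+1%:R :> R by rewrite mulr_ge0.
have key t : 0 < t -> t <= 1 -> (n * a)%:R ^+ 2 / u%:R <= 4 * k.+1%:R * X ^+ 2 * t ->
    ((n * a)%:R ^+ 2 / u%:R) `^ E <= (4 * k.+1%:R) `^ E * X `^ (E * 2) * t `^ E.
  move=> t0 t1 le; have t0' := ltW t0.
  have X20 := sqr_ge0 X; have cX := mulr_ge0 c0 X20.
  rewrite -powRX2// -(powRM E c0 X20) -(powRM E cX t0').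
  apply: ge0_ler_powR => //; rewrite nnegrE; last exact: mulr_ge0.
  by rewrite divr_ge0 ?sqr_ge0.
have mono t r : 0 < t -> t <= 1 -> r <= E -> t `^ E <= t `^ r.
  by move=> t0 t1 rE; apply: ger_powR => //; rewrite t0.
have NaE : (n * a)%:R = X * ((m * a)%:R / n%:R).
  by rewrite /X !natrM; field; rewrite !lt0r_neq0.
have P0 : 0 <= (4 * k.+1%:R) `^ E * X `^ (E * 2) by rewrite mulr_ge0 ?powR_ge0.
have [un|nu] := leqP u n.
  have t1 : u%:R^-1 <= 1 :> R by rewrite invf_le1// ler1n.
  have t0 : 0 < u%:R^-1 :> R by rewrite invr_gt0.
  apply: le_trans (key _ t0 t1 _) _; last first.
    rewrite ler_wpM2l// (le_trans (mono _ _ t0 t1 E32))// lerDl invr_ge0.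
    exact: ler0n.
  apply: ler_wpM2r; first exact: ltW.
  rewrite NaE exprMn [leLHS]mulrC; apply: ler_wpM2r; first exact: sqr_ge0.
  apply: (@le_trans _ _ (2 ^+ 2)).
    rewrite lerXn2r ?nnegrE ?divr_ge0// ler_pdivrMr// -natrM ler_nat maE.
    by rewrite mul2n -addnn leq_add2r.
  by rewrite -natrX -natrM ler_nat leq_pmulr.
have t1 : n%:R^-1 <= 1 :> R by rewrite invf_le1// ler1n.
have t0 : 0 < n%:R^-1 :> R by rewrite invr_gt0.
apply: le_trans (key _ t0 t1 _) _; last first.
  apply: ler_wpM2l => //; apply: le_trans (mono _ _ t0 t1 E1) _.
  by rewrite (powRr1 (ltW t0)) lerDr powR_ge0.
rewrite NaE exprMn -[leLHS]mulrA [leRHS]mulrAC [leRHS]mulrC.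
apply: ler_wpM2l; first exact: sqr_ge0.
rewrite expr_div_n ler_pdivrMr// ler_pdivrMr ?exprn_gt0//.
have -> : 4 * k.+1%:R / n%:R * u%:R * n%:R ^+ 2 = (4 * k.+1 * u * n)%:R :> R.
  by rewrite !natrM; field; rewrite lt0r_neq0.
rewrite -natrX ler_nat -mulnn.
(* One factor [m a = u + n] is at most [2 u], as [n < u]; the other is at most [(k + 1) n]. *)
apply: (@leq_trans (2 * u * (k.+1 * n))%N).
  by rewrite leq_mul// maE mul2n -addnn leq_add2l ltnW.
have -> : (4 * k.+1 * u * n = 2 * (2 * u * (k.+1 * n)))%N by ring.
by rewrite leq_pmull.
Qed.

Lemma size_firsts m n : (size (firsts k.+1 m n) <= k.+1 * n)%N.
Proof.
rewrite -[leqRHS](size_iota 1); apply: uniq_leq_size; first exact: firsts_uniq.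
move=> a aP; have := aP; rewrite mem_firsts => /andP[a1 _].
have /andP[_ a0] : (0 < m)%N && (0 < a)%N by rewrite -muln_gt0 (leq_ltn_trans _ a1).
move: aP; rewrite mem_filter !mem_iota add0n => /andP[_ /andP[_ a2]].
by rewrite a0 add1n.
Qed.

(** In the factor [k + 4 = 3 + (k + 1)], the 3 bounds the sum of [u ^ (- 3 / 2)], and [k + 1] bounds
    the at most [(k + 1) n] terms [1 / n]. *)
Lemma egyptian_count_step m n : (0 < m)%N -> (0 < n)%N ->
  (egyptian_count k.+1 m n)%:R <=
  D * ((4 * k.+1%:R) `^ E * k.+4%:R) * (n%:R ^+ 2 / m%:R) `^ (E * 2).
Proof.
move=> m0 n0.
have n0' : 0 < n%:R :> R by rewrite ltr0n.
pose P : R := (4 * k.+1%:R) `^ E * (n%:R ^+ 2 / m%:R) `^ (E * 2).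
have P0 : 0 <= P by rewrite mulr_ge0 ?powR_ge0.
pose w (i : nat) : R := i%:R^-1 `^ (3 / 2).
apply: (@le_trans _ _ (\sum_(a <- firsts k.+1 m n)
    (egyptian_count k (m * a - n) (n * a))%:R)).
  by rewrite -natr_sum ler_nat; exact: egyptian_count_rec.
apply: (@le_trans _ _ (\sum_(a <- firsts k.+1 m n)
    (D * (P * (w (m * a - n)%N + n%:R^-1))))).
  rewrite big_seq [leRHS]big_seq; apply: ler_sum => a aP.
  have := aP; rewrite mem_firsts => /andP[a1 _].
  have /andP[_ a0] : (0 < m)%N && (0 < a)%N by rewrite -muln_gt0 (leq_ltn_trans _ a1).
  apply: le_trans (hk _ _) _; rewrite ?subn_gt0 ?muln_gt0 ?n0//.
  by rewrite ler_wpM2l//; exact: egyptian_step_term.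
rewrite -!mulr_sumr.
have -> : D * ((4 * k.+1%:R) `^ E * k.+4%:R) * (n%:R ^+ 2 / m%:R) `^ (E * 2) =
  D * (P * k.+4%:R) by rewrite /P; ring.
rewrite ler_wpM2l// ler_wpM2l// big_split/=.
have -> : k.+4%:R = 3 + k.+1%:R :> R by rewrite -natrD.
apply: lerD.
  apply: le_trans (sum_powR32_le R (k.+1 * n)).
  by apply: (@sum_firsts _ k.+1 m n _ w) => // i; exact: powR_ge0.
rewrite big_const_seq count_predT iter_addr_0 -[leLHS]mulr_natl ler_pdivrMr//.
by rewrite -natrM ler_nat size_firsts.
Qed.

End Step.

(** * Induction on the number of terms *)

Lemma exponentS (R : realType) k : (5 <= k)%N ->
  8 / 5 * 2 ^+ (k.+1 - 5) = 8 / 5 * 2 ^+ (k - 5) * 2 :> R.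
Proof. by move=> k5; rewrite subSn// exprSr mulrA. Qed.

Lemma exponent_ge (R : realType) k : 8 / 5 <= 8 / 5 * 2 ^+ (k - 5) :> R.
Proof. by rewrite ler_peMr ?divr_ge0// exprn_ege1// ler1n. Qed.

(** For [k] up to a fixed [K] the losses of [egyptian_count_step] are finitely many constants, and
    adding them up gives one constant for all these [k]. *)
Lemma few_terms (R : realType) (K : nat) : exists2 C : R, 0 < C & forall k m n,
  (5 <= k <= K)%N -> (0 < m)%N -> (0 < n)%N ->
  (egyptian_count k m n)%:R <= C * (n%:R ^+ 2 / m%:R) `^ (8 / 5 * 2 ^+ (k - 5)).
Proof.
elim: K => [|K [C C0 IH]].
  by exists 1 => // k m n /andP[k5 k0]; have := leq_trans k5 k0.
have [K5|K5] := ltnP K 5.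
  have [C' C'0 hC'] := five_terms R.
  exists C' => // k m n /andP[k5 kK] m0 n0.
  have -> : k = 5%N by apply/eqP; rewrite eqn_leq k5 (leq_trans kK).
  by rewrite subnn expr0 mulr1; exact: hC'.
pose E : R := 8 / 5 * 2 ^+ (K - 5).
pose C' : R := C * ((4 * K.+1%:R) `^ E * K.+4%:R).
have C'0 : 0 <= C' by rewrite mulr_ge0 ?ltW// mulr_gt0 ?powR_gt0 ?mulr_gt0 ?ltr0n.
exists (C + C') => [|k m n /andP[k5]]; first by rewrite ltr_pwDl.
rewrite leq_eqVlt => /orP[/eqP ->|kK] m0 n0.
  apply: (@le_trans _ _ (C' * (n%:R ^+ 2 / m%:R) `^ (E * 2))).
    apply: egyptian_count_step => //; [exact: leq_trans K5|exact: ltW| |].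
      by apply: le_trans (exponent_ge R K); lra.
    by move=> m' n' m'0 n'0; apply: IH => //; rewrite K5 leqnn.
  by rewrite exponentS// ler_wpM2r ?powR_ge0// lerDr ltW.
apply: (@le_trans _ _ (C * (n%:R ^+ 2 / m%:R) `^ (8 / 5 * 2 ^+ (k - 5)))).
  by apply: IH => //; rewrite k5.
by rewrite ler_wpM2r ?powR_ge0// lerDl.
Qed.

(* Both [(k + 1) ^ (E / 6) >= 4 ^ E] and [(k + 1) ^ (E / 6) >= (k + 1) ^ 2] hold,
   since [4 ^ 6 <= k] and [12 <= E]. *)
Lemma step_factor_le (R : realType) k (E : R) : (4 ^ 6 <= k)%N -> 12 <= E ->
  k%:R `^ (4 / 3 * E) * ((4 * k.+1%:R) `^ E * k.+4%:R) <=
  k.+1%:R `^ (4 / 3 * (E * 2)).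
Proof.
move=> k6 E12.
have E0 : 0 <= E by exact: le_trans E12.
have k0 : (0 < k)%N by apply: leq_trans k6; rewrite expn_gt0.
pose x : R := k.+1%:R.
have x0 : 0 < x by rewrite ltr0n.
have x1 : 1 <= x by rewrite ler1n.
have xx a b : x `^ (a + b) = x `^ a * x `^ b by rewrite powRD// (gt_eqF x0) implybT.
(* The four summands absorb in turn [k ^ (4 / 3 E)], [(k + 1) ^ E], [4 ^ E] and [k + 4]. *)
have -> : 4 / 3 * (E * 2) = 4 / 3 * E + (E + (E / 6 + E / 6)) by field.
rewrite !xx; apply: ler_pM; rewrite ?powR_ge0// ?mulr_ge0 ?powR_ge0//.
  apply: ge0_ler_powR; rewrite ?nnegrE ?mulr_ge0 ?divr_ge0//.
  by rewrite /x ler_nat.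
rewrite powRM// [X in X * _]mulrC -mulrA; apply: ler_wpM2l; first exact: powR_ge0.
apply: ler_pM; rewrite ?powR_ge0//.
  rewrite [E / 6]mulrC powRrM; apply: ge0_ler_powR; rewrite ?nnegrE ?powR_ge0//.
  have -> : 4 = (x ^+ 0 * 4 ^+ 6) `^ 6^-1 :> R.
    by rewrite expr0 mul1r -powR_mulrn// -powRrM mulfV// powRr1.
  apply: ge0_ler_powR; rewrite ?nnegrE ?invr_ge0//.
    by rewrite expr0 mul1r exprn_ge0.
  by rewrite expr0 mul1r -natrX ler_nat (leq_trans k6).
apply: (@le_trans _ _ (x `^ 2%:R)).
  rewrite powR_mulrn// -natrX ler_nat.
  have : (4 <= k)%N by apply: leq_trans k6.
  nia.
by apply: ler_powR => //; rewrite ler_pdivlMr//; apply: le_trans E12; lra.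
Qed.

Theorem theorem2 (R : realType) (eps : R) (heps : 0 < eps) :
  exists C : R, 0 < C /\
    forall m n k : nat, (0 < m)%N -> (0 < n)%N -> (5 <= k)%N ->
      (egyptian_count k m n)%:R <=
        C * ((k * n)%:R `^ eps) *
        ((k%:R `^ (4 / 3) * n%:R ^+ 2 / m%:R) `^ (8 / 5 * 2 ^+ (k - 5))).
Proof.
pose E k : R := 8 / 5 * 2 ^+ (k - 5).
have E0 k : 0 <= E k by apply: le_trans (exponent_ge R k); lra.
(* The threshold from which [step_factor_le] applies. *)
have [K KE] : exists K, K = (4 ^ 6)%N by exists (4 ^ 6)%N.
have [C C0 hC] := few_terms R K.
exists C; split=> // m n k m0 n0 k5.
have k1 : (1 <= k)%N by exact: leq_trans k5.
(* Up to [K] this is [few_terms], as [k ^ (4 / 3 E) >= 1]. Beyond [K], induction keeps the same [C]: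
   each loss is absorbed by the growth of [k ^ (4 / 3 E)]. *)
have main : (egyptian_count k m n)%:R <=
    C * k%:R `^ (4 / 3 * E k) * (n%:R ^+ 2 / m%:R) `^ E k.
  have small j m' n' : (5 <= j <= K)%N -> (0 < m')%N -> (0 < n')%N ->
      (egyptian_count j m' n')%:R <=
      C * j%:R `^ (4 / 3 * E j) * (n'%:R ^+ 2 / m'%:R) `^ E j.
    move=> /[dup] jK /andP[j5 _] m'0 n'0; apply: le_trans (hC _ _ _ jK m'0 n'0) _.
    apply: ler_wpM2r; first exact: powR_ge0.
    apply: ler_peMr; first exact: ltW.
    rewrite -[leLHS](powRr0 j%:R); apply: ler_powR; last by rewrite mulr_ge0.
    by rewrite ler1n (leq_trans _ j5).
  have [kK|/ltnW Kk] := leqP k K; first by apply: small => //; rewrite k5 kK.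
  rewrite -(subnK Kk); move: m n m0 n0 (k - K)%N {k5 k1 Kk} => m n m0 n0 i.
  elim: i m n m0 n0 => [|i IH] m n m0 n0.
    by rewrite add0n; apply: small => //; rewrite leqnn andbT KE.
  rewrite addSn; set j := (i + K)%N in IH *.
  have jK : (4 ^ 6 <= j)%N by rewrite -KE leq_addl.
  have j8 : (8 <= j)%N by apply: leq_trans jK.
  have j5 : (5 <= j)%N by apply: leq_trans j8.
  have ES : E j.+1 = E j * 2 by exact: exponentS.
  have D0 : 0 <= C * j%:R `^ (4 / 3 * E j).
    by apply: mulr_ge0; [exact: ltW|exact: powR_ge0].
  have E32 : 3 / 2 <= E j by apply: le_trans (exponent_ge R j); lra.
  (* Already at [j = 8] the exponent is [8 / 5 * 2 ^ 3 = 12.8]. *)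
  have E12 : 12 <= E j.
    apply: (@le_trans _ _ (8 / 5 * 2 ^+ 3)); first lra.
    by rewrite ler_wpM2l ?divr_ge0// ler_weXn2l ?ler1n// leq_subRL.
  have j0 : (0 < j)%N by apply: leq_trans j5.
  apply: le_trans (egyptian_count_step j0 D0 E32 IH m0 n0) _.
  rewrite ES; apply: ler_wpM2r; first exact: powR_ge0.
  rewrite -mulrA; apply: ler_wpM2l; first exact: ltW.
  exact: step_factor_le.
apply: le_trans main _.
have kn1 : 1 <= (k * n)%:R `^ eps.
  rewrite -[leLHS](powRr0 (k * n)%:R); apply: ler_powR; last exact: ltW.
  by rewrite ler1n muln_gt0 k1.
rewrite -[k%:R `^ (4 / 3) * _ / _]mulrA powRM ?powR_ge0 ?divr_ge0 ?exprn_ge0//.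
rewrite -powRrM mulrA ler_wpM2r ?powR_ge0// ler_wpM2r ?powR_ge0//.
by rewrite ler_peMr// ltW.
Qed.
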